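(* The deterministic lattice process $\pi(p=1,v=1,r=1/2,\mathbb{Z})$, i.e. the map $T:\{0,1\}^{\mathbb{Z}}\to\{0,1\}^{\mathbb{Z}}$ described in the context, possesses a Markov invariant probability measure $\mu$ which is a weighted sum $\mu=\alpha\mu_++\beta\mu_-$ (with weights $\alpha,\beta\ge0$, $\alpha+\beta=1$) of the two measures of maximal entropy $\mu_\pm$ of the shift-maps $\sigma_\pm$ (acting in opposite directions) on $B_\pm$. Besides, there is a one-parameter family $\{\mu_\rho\}_{\rho\in[0,1]}$ of $T$-invariant probability measures such that $E_{\mu_\rho}[x_i]=\rho$ for all $i\in\mathbb{Z}$, where $x_i\in\{0,1\}$ is the occupation number of the site $i$.
   Context: Process. A configuration of particles on $\mathbb{Z}$ with at most one particle per site is identified with a binary sequence $x\in\{0,1\}^{\mathbb{Z}}$, where $x_i=1$ means that site $i$ is occupied and $x_i=0$ that it is empty. $T$ is the map in which, simultaneously, every particle at a site $i$ whose right neighbour $i+1$ is empty moves to $i+1$, and all other particles stay; that is, $(Tx)_i=1$ iff ($x_i=1$ and $x_{i+1}=1$) or ($x_i=0$ and $x_{i-1}=1$). Shift-maps. $B_+:=\{b\in\{0,1\}^{\mathbb{Z}}: b_i+b_{i+1}\ne2\ \forall i\}$ and $B_-:=\{b\in\{0,1\}^{\mathbb{Z}}: b_i+b_{i+1}\ne0\ \forall i\}$. The shift-maps are $(\sigma_+b)_i:=b_{i-1}$ and $(\sigma_-b)_i:=b_{i+1}$; one has $\sigma_\pm B_\pm=B_\pm$. $\mu_\pm$ is the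 (unique) measure of maximal entropy of the subshift of finite type $(\sigma_\pm,B_\pm)$, regarded as a measure on $\{0,1\}^{\mathbb{Z}}$. Markov measure. A (translation invariant) probability measure $\mu$ on $\{0,1\}^{\mathbb{Z}}$ is called Markov if $\mu([b])\,\mu([AbC])=\mu([Ab])\,\mu([bC])$ for all finite binary words $A,C$ and every single letter $b\in\{0,1\}$, where $[w]$ denotes the cylinder of all sequences containing the word $w$ at a fixed position. *)

(* Defs.v *)
From HB Require Import structures.
From mathcomp Require Import all_boot all_order all_algebra.
From mathcomp Require Import all_classical all_reals all_analysis.
Set Implicit Arguments.
Unset Strict Implicit.
Unset Printing Implicit Defensive.
Import Order.TTheory GRing.Theory Num.Theory.
Import numFieldNormedType.Exports.
Local Open Scope classical_set_scope.
Local Open Scope ring_scope.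

Definition coordinate_events : set (set (int -> bool)) :=
  [set A | exists (i : int) (b : bool), A = [set x | x i = b]].

(* {0,1}^Z with the product sigma-algebra. *)
Definition config := g_sigma_algebraType coordinate_events.

Definition tasep_map (x : config) : config :=
  fun i : int => (x i && x (i + 1)) || (~~ x i && x (i - 1)).

Definition B_plus : set config :=
  [set b | forall i : int, (b i + b (i + 1)%R)%N <> 2%N].

Definition B_minus : set config :=
  [set b | forall i : int, (b i + b (i + 1)%R)%N <> 0%N].

Definition shift_plus (b : config) : config := fun i : int => b (i - 1).

Definition shift_minus (b : config) : config := fun i : int => b (i + 1).

Definition translate (k : int) (x : config) : config := fun i : int => x (i + k).

Definition invariant_measure (d : measure_display) (T : measurableType d)
    (R : realType) (f : T -> T) (mu : probability T R) : Prop :=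
  forall A : set T, measurable A -> mu (f @^-1` A) = mu A.

(* Measures of the library are functions on all sets, unconstrained on the
   nonmeasurable ones, so measures are compared on measurable sets only. *)
Definition same_measure (d : measure_display) (T : measurableType d)
    (R : realType) (mu nu : probability T R) : Prop :=
  forall A : set T, measurable A -> mu A = nu A.

Definition measurable_partition (d : measure_display) (T : measurableType d)
    (k : nat) (A : 'I_k -> set T) : Prop :=
  [/\ forall i, measurable (A i), trivIset setT A & \bigcup_i A i = setT].

(* Atom, labelled by w, of the join of the f^-i A for 0 <= i < n. *)
Definition itinerary_atom (T : Type) (f : T -> T) (k : nat)
    (A : 'I_k -> set T) (n : nat) (w : {ffun 'I_n -> 'I_k}) : set T :=
  [set x | forall i : 'I_n, A (w i) (iter i f x)].

(* Null atoms contribute 0 * ln 0 = 0. *)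
Definition join_entropy (d : measure_display) (T : measurableType d)
    (R : realType) (mu : probability T R) (f : T -> T) (k : nat)
    (A : 'I_k -> set T) (n : nat) : R :=
  - \sum_(w : {ffun 'I_n -> 'I_k})
      fine (mu (itinerary_atom f A w)) * ln (fine (mu (itinerary_atom f A w))).

Definition partition_entropy (d : measure_display) (T : measurableType d)
    (R : realType) (mu : probability T R) (f : T -> T) (k : nat)
    (A : 'I_k -> set T) : R :=
  limn (fun n : nat => join_entropy mu f A n / n%:R).

Definition ks_entropy (d : measure_display) (T : measurableType d)
    (R : realType) (mu : probability T R) (f : T -> T) : \bar R :=
  ereal_sup [set h | exists (k : nat) (A : 'I_k -> set T),
    measurable_partition A /\ h = (partition_entropy mu f A)%:E].

(* Invariant measures of the subsystem (f, B) are represented by the invariant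
   measures of the ambient space giving full mass to B. *)
Definition subsystem_measure (d : measure_display) (T : measurableType d)
    (R : realType) (f : T -> T) (B : set T) (mu : probability T R) : Prop :=
  invariant_measure f mu /\ mu B = 1%E.

Definition max_entropy_measure (d : measure_display) (T : measurableType d)
    (R : realType) (f : T -> T) (B : set T) (mu : probability T R) : Prop :=
  subsystem_measure f B mu /\
  forall nu : probability T R, subsystem_measure f B nu ->
    (ks_entropy nu f <= ks_entropy mu f)%E.

Definition the_max_entropy_measure (d : measure_display) (T : measurableType d)
    (R : realType) (f : T -> T) (B : set T) (mu : probability T R) : Prop :=
  max_entropy_measure f B mu /\
  forall nu : probability T R, max_entropy_measure f B nu -> same_measure nu mu.

Definition cylinder (w : seq bool) : set config :=
  [set x | forall j : nat, (j < size w)%N -> x (j%:Z) = nth false w j].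

Definition markov_measure (R : realType) (mu : probability config R) : Prop :=
  (forall k : int, invariant_measure (translate k) mu) /\
  forall (A C : seq bool) (b : bool),
    (mu (cylinder [:: b]) * mu (cylinder (A ++ b :: C)) =
     mu (cylinder (rcons A b)) * mu (cylinder (b :: C)))%E.

Definition occupation (R : realType) (i : int) (x : config) : R := (x i)%:R.

(* Main.v *)
Require Import Defs.
From mathcomp Require Import all_boot all_order all_algebra.
From mathcomp Require Import all_classical all_reals all_analysis.
From mathcomp Require Import measurable_realfun zify ring lra.
Set Implicit Arguments.
Unset Strict Implicit.
Unset Printing Implicit Defensive.
Import Order.TTheory GRing.Theory Num.Theory.
Import numFieldNormedType.Exports.
Local Open Scope classical_set_scope.
Local Open Scope ring_scope.

(** On [B_plus] no two neighbouring sites are occupied, so every particle moves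
    and [tasep_map] is [shift_plus]; on [B_minus] no two neighbouring sites are
    empty, every hole moves to the left, and [tasep_map] is [shift_minus]. A
    measure of maximal entropy of either subshift is therefore invariant under
    [tasep_map], and since the subshifts are golden mean shifts it is the Parry
    measure, a Markov chain. The mixture is taken with the weights 0 and 1: a
    proper mixture of the two chains does not satisfy the Markov equations.
    The family with prescribed density consists of the mixtures of the empty and
    the full configuration, which are fixed points ([constant_configurations]).

    The work lies in the measure of maximal entropy, for the entropy defined as
    a supremum over all finite measurable partitions. Reflection and
    complementation conjugate both subshifts to ([shift_minus], [B_plus]), and
    [the_max_entropy_measure_conjugate] transports the result; on that system
    three facts are needed.

    Upper bound. All entropy estimates come from one source,
    [gibbs_inequality]: replacing the true law by a reference law inside the
    logarithm can only increase the entropy, strictly so if they differ. With a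
    substochastic kernel as reference, [itinerary_entropy_le] bounds the entropy
    of an itinerary by a constant plus the number of steps times the mean of
    minus the logarithm of the kernel. To treat an arbitrary partition, it is
    approximated by one read off a finite window ([label_approx]); the kernel
    predicts the next window letter by a given predictor and the label of the
    partition by its approximation, with an exponentially small weight for
    errors ([partition_entropy_le]). The cost of the labels tends to 0, and
    [ks_entropy_le] follows: for every predictor of a letter from the preceding
    N letters, the entropy of the shift is at most the mean of minus the
    logarithm of the predictor; this comparison plays the part of the theorem on
    generators. The Parry transition probabilities, taken as predictor, give the
    bound - ln s with s = (sqrt 5 - 1) / 2, because their logarithm is ln s plus
    a coboundary ([parry_rate]).

    Uniqueness. Let nu have entropy at least - ln s. With the conditional
    probabilities of nu itself given N letters as predictor, [ks_entropy_le]
    gives - ln s as a lower bound for a conditional entropy, for which the Gibbs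
    inequality against the Parry kernel gives the upper bound - ln s. The
    equality case forces the transition probabilities of nu to be those of Parry
    for every N >= 1 ([max_entropy_parry_transitions]), and these determine an
    invariant measure ([parry_transitions_unique]).

    Existence. A two-sided chain is the image of Lebesgue measure on [0, 1[
    under a map reading off nested intervals whose lengths are the weights of
    words grown alternately to the right and to the left
    ([word_weights_extend]). Its word entropies grow exactly by - ln s per
    letter, so the partition according to the letter at the origin already has
    entropy - ln s. *)

(** * Finite-valued random variables and Shannon entropy *)

Definition finitely_valued (d : measure_display) (T : measurableType d)
    (I : finType) (X : T -> I) : Prop :=
  forall i, measurable (X @^-1` [set i]).

Definition prob (d : measure_display) (T : measurableType d) (R : realType)
    (nu : probability T R) (A : set T) : R := fine (nu A).

Definition law (d : measure_display) (T : measurableType d) (R : realType)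
    (nu : probability T R) (I : finType) (X : T -> I) (i : I) : R :=
  prob nu (X @^-1` [set i]).

Definition shannon (d : measure_display) (T : measurableType d) (R : realType)
    (nu : probability T R) (I : finType) (X : T -> I) : R :=
  - \sum_i law nu X i * ln (law nu X i).

Section finite_variables.
Context (d : measure_display) (T : measurableType d) (R : realType).
Context (nu : probability T R).
Implicit Types (A B : set T) (I J : finType).

Lemma probE A : measurable A -> (prob nu A)%:E = nu A.
Proof. by move=> mA; rewrite /prob fineK// fin_num_measure. Qed.

Lemma prob_ge0 A : 0 <= prob nu A.
Proof. exact/fine_ge0/measure_ge0. Qed.

Lemma prob_setT : prob nu setT = 1.
Proof. by rewrite /prob probability_setT. Qed.

Lemma le_prob A B : measurable A -> measurable B -> A `<=` B ->
  prob nu A <= prob nu B.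
Proof.
move=> mA mB AB; rewrite -lee_fin !probE//.
by apply: le_measure; rewrite ?inE.
Qed.

Lemma prob_setU A B : measurable A -> measurable B ->
  prob nu (A `|` B) <= prob nu A + prob nu B.
Proof.
move=> mA mB; rewrite -lee_fin EFinD !probE//; last exact: measurableU.
by rewrite measureU2.
Qed.

Lemma finitely_valued_pred I (X : T -> I) (P : pred I) :
  finitely_valued X -> measurable [set x | P (X x)].
Proof.
move=> mX.
rewrite (_ : [set x | P (X x)] = \bigcup_(i in [set` P]) (X @^-1` [set i])).
  by apply: fin_bigcup_measurable => //; exact: finite_finset.
apply/seteqP; split=> [x Px|x [i Pi xi]]; first by exists (X x).
by move: Pi; rewrite /= -xi.
Qed.

Lemma prob_pred I (X : T -> I) (P : pred I) : finitely_valued X ->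
  prob nu [set x | P (X x)] = \sum_(i | P i) law nu X i.
Proof.
move=> mX.
rewrite (_ : [set x | P (X x)] =
    \bigcup_(i in [set` P]) (X @^-1` [set i])); last first.
  apply/seteqP; split=> [x Px|x [i Pi xi]]; first by exists (X x).
  by move: Pi; rewrite /= -xi.
rewrite /prob measure_fin_bigcup//.
- rewrite -(@bigfs _ _ _ _ (index_enum I)) ?index_enum_uniq//; last first.
    by move=> i _; rewrite mem_index_enum.
  by rewrite /law /prob sum_fine// => i _; exact: fin_num_measure.
- by move=> i j _ _ [x [<- <-]].
Qed.

Lemma law_ge0 I (X : T -> I) i : 0 <= law nu X i.
Proof. exact: prob_ge0. Qed.

Lemma sum_law I (X : T -> I) : finitely_valued X -> \sum_i law nu X i = 1.
Proof.
move=> mX; rewrite -(@prob_pred I X predT)// -[RHS]prob_setT; congr prob.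
by apply/seteqP; split.
Qed.

Lemma finitely_valued_comp I J (X : T -> I) (h : I -> J) :
  finitely_valued X -> finitely_valued (h \o X).
Proof.
move=> mX j; rewrite (_ : _ @^-1` _ = [set x | h (X x) == j]).
  exact: (@finitely_valued_pred _ X (fun i => h i == j)).
by apply/seteqP; split=> x /= /eqP.
Qed.

Lemma law_comp I J (X : T -> I) (h : I -> J) j : finitely_valued X ->
  law nu (h \o X) j = \sum_(i | h i == j) law nu X i.
Proof.
move=> mX; rewrite -(@prob_pred _ X (fun i => h i == j))//; congr prob.
by apply/seteqP; split=> x /= /eqP.
Qed.

Lemma sum_law_comp I J (X : T -> I) (h : I -> J) (G : J -> R) :
  finitely_valued X ->
  \sum_j law nu (h \o X) j * G j = \sum_i law nu X i * G (h i).
Proof.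
move=> mX; rewrite [RHS](partition_big h predT)//=; apply: eq_bigr => j _.
rewrite law_comp// mulr_suml; apply: eq_big => // i /eqP ->//.
Qed.

Lemma law_comp_ge I J (X : T -> I) (h : I -> J) i : finitely_valued X ->
  law nu X i <= law nu (h \o X) (h i).
Proof.
move=> mX; rewrite law_comp// (bigD1 i)//= lerDl.
by apply: sumr_ge0 => k _; exact: law_ge0.
Qed.

Lemma ler_sum_law I (X : T -> I) (G H : I -> R) :
  (forall i, 0 < law nu X i -> G i <= H i) ->
  \sum_i law nu X i * G i <= \sum_i law nu X i * H i.
Proof.
move=> GH; apply: ler_sum => i _; have := law_ge0 X i.
rewrite le_eqVlt => /predU1P[<-|p]; first by rewrite !mul0r.
by rewrite ler_pM2l// GH.
Qed.

Lemma eq_sum_law I (X : T -> I) (G H : I -> R) :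
  (forall i, 0 < law nu X i -> G i = H i) ->
  \sum_i law nu X i * G i = \sum_i law nu X i * H i.
Proof.
by move=> GH; apply/eqP; rewrite eq_le !ler_sum_law// => i /GH ->.
Qed.

Lemma finitely_valued_ffun I J (X : I -> T -> J) :
  (forall i, finitely_valued (X i)) ->
  finitely_valued (fun x => [ffun i => X i x]).
Proof.
move=> mX w.
rewrite (_ : _ @^-1` _ = \bigcap_(i in [set: I]) (X i @^-1` [set w i])).
  by apply: fin_bigcap_measurable => [|i _]; [exact: finite_finset|exact: mX].
apply/seteqP; split=> x /= => [<- i _|xw]; first by rewrite /= ffunE.
by apply/ffunP => i; rewrite ffunE (xw i).
Qed.

Lemma finitely_valued_pair I J (X : T -> I) (Y : T -> J) :
  finitely_valued X -> finitely_valued Y ->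
  finitely_valued (fun x => (X x, Y x)).
Proof.
move=> mX mY [i j].
rewrite (_ : _ @^-1` _ = X @^-1` [set i] `&` Y @^-1` [set j]).
  exact: measurableI.
by apply/seteqP; split=> x /= [-> ->].
Qed.

(** The value of [h \o X] is at least as likely as the value of [X] it comes
    from. *)
Lemma shannon_comp I J (X : T -> I) (h : I -> J) : finitely_valued X ->
  shannon nu (h \o X) <= shannon nu X.
Proof.
move=> mX; rewrite /shannon lerN2 (sum_law_comp _ (fun j => ln _))//.
apply: ler_sum_law => i p; rewrite ler_ln ?posrE//; first exact: law_comp_ge.
exact: lt_le_trans p (law_comp_ge _ _ _).
Qed.

Lemma ln_le_subr1 (x : R) : 0 < x -> ln x <= x - 1.
Proof.
move=> x0; rewrite -ler_expR lnK ?posrE//.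
by have := expR_ge1Dx (x - 1); rewrite addrC subrK.
Qed.

Lemma ln_eq_subr1 (x : R) : 0 < x -> ln x = x - 1 -> x = 1.
Proof.
move=> x0 e; apply/eqP; apply/negPn/negP => x1.
have := @expR_gt1Dx _ (x - 1); rewrite subr_eq0 => /(_ x1).
by rewrite -e lnK ?posrE// e addrC subrK ltxx.
Qed.

End finite_variables.

(** * The Gibbs inequality and the entropy of itineraries *)

(** Summation of x ln (y / x) <= y - x, which is strict unless x = y. *)
Lemma gibbs_inequality (R : realType) (I : finType) (p q : I -> R) :
  (forall i, 0 <= p i) -> (forall i, 0 <= q i) ->
  \sum_i q i <= \sum_i p i -> (forall i, 0 < p i -> 0 < q i) ->
  \sum_i p i * ln (q i) <= \sum_i p i * ln (p i) ?= iff [forall i, p i == q i].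
Proof.
move=> p0 q0 qp pq.
have term i : p i * ln (q i) - p i * ln (p i) <= q i - p i
              ?= iff (p i == q i).
  have := p0 i; rewrite le_eqVlt => /predU1P[<-|pi0].
    rewrite !mul0r !subr0; apply/leifP; case: eqP => // /eqP q_neq0.
    by rewrite lt_neqAle q_neq0 q0.
  have qi0 := pq _ pi0.
  have r0 : 0 < q i / p i by rewrite divr_gt0.
  rewrite -mulrBr -ln_div ?posrE//.
  have -> : q i - p i = p i * (q i / p i - 1).
    by rewrite mulrBr mulr1 mulrC divfK ?gt_eqF.
  apply/leifP; case: eqP => [->|npq].
    by rewrite (divff (lt0r_neq0 qi0)) ln1 subrr.
  rewrite ltr_pM2l// lt_neqAle ln_le_subr1// andbT.
  apply/eqP => /(ln_eq_subr1 r0) e; apply: npq.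
  by rewrite -[RHS](@divfK _ (p i)) ?gt_eqF// e mul1r.
have [le_sum eq_sum] := leif_sum (fun i (_ : true) => term i).
rewrite !sumrB in le_sum eq_sum.
have le0 : \sum_i p i * ln (q i) - \sum_i p i * ln (p i) <= 0.
  by rewrite (le_trans le_sum)// subr_le0.
split; first by rewrite -subr_le0.
apply/eqP/forallP => [e i|e].
  move: eq_sum; rewrite e subrr => eq_sum.
  suff : [forall (i | true), p i == q i] by move/forallP => /(_ i).
  rewrite -eq_sum eq_le -{1}[0](subrr (\sum_i p i * ln (p i))) -{1}e.
  by rewrite le_sum subr_le0.
by apply: eq_bigr => i _; rewrite (eqP (e i)).
Qed.

Section conditional.
Context (d : measure_display) (T : measurableType d) (R : realType).
Context (nu : probability T R) (I J : finType).
Context (X : T -> I) (Y : T -> J) (K : I -> J -> R).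
Hypotheses (mX : finitely_valued X) (mY : finitely_valued Y).
Hypothesis K_ge0 : forall i j, 0 <= K i j.
Hypothesis K_le1 : forall i, \sum_j K i j <= 1.
Hypothesis K_gt0 :
  forall z, 0 < law nu (fun x => (X x, Y x)) z -> 0 < K z.1 z.2.

Local Notation XY := (fun x => (X x, Y x)).

(** The Gibbs inequality for the reference law that keeps the true law of [X]
    and draws [Y] from the kernel [K]. The equality case identifies the
    conditional law of [Y] given [X] with [K]. *)
Lemma shannon_pair_leif :
  shannon nu XY <= shannon nu X - \sum_z law nu XY z * ln (K z.1 z.2)
    ?= iff [forall z, law nu XY z == law nu X z.1 * K z.1 z.2].
Proof.
have mXY : finitely_valued XY by exact: finitely_valued_pair.
have mono z : law nu XY z <= law nu X z.1.
  exact: (@law_comp_ge _ _ _ nu _ _ XY fst z mXY).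
have := @gibbs_inequality R _ (law nu XY) (fun z => law nu X z.1 * K z.1 z.2).
case.
- by move=> i; exact: law_ge0.
- by move=> i; rewrite mulr_ge0// law_ge0.
- rewrite sum_law// -(sum_law nu mX).
  rewrite -(pair_bigA _ (fun i j => law nu X i * K i j))/=.
  apply: ler_sum => i _; rewrite -mulr_sumr ler_piMr// ?K_le1//.
  exact: law_ge0.
- by move=> z z0; rewrite mulr_gt0 ?K_gt0// (lt_le_trans z0 (mono z)).
have -> : \sum_i law nu XY i * ln (law nu X i.1 * K i.1 i.2)
        = - shannon nu X + \sum_z law nu XY z * ln (K z.1 z.2).
  rewrite /shannon opprK.
  rewrite (@sum_law_comp _ _ _ nu _ _ XY fst (fun i => ln (law nu X i)))//.
  rewrite -big_split/=; under [RHS]eq_bigr do rewrite -mulrDr.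
  apply: eq_sum_law => z z0; rewrite lnM// ?posrE ?K_gt0//.
  exact: lt_le_trans z0 (mono z).
move=> le eq; split.
  by rewrite [leLHS]/shannon; lra.
rewrite -eq -subr_eq0 -[in RHS]subr_eq0 /shannon.
by congr (_ == _); ring.
Qed.

End conditional.

Section itineraries.
Context (d : measure_display) (T : measurableType d) (R : realType).
Context (nu : probability T R) (f : T -> T).
Hypotheses (mf : measurable_fun setT f) (inv : invariant_measure f nu).

Definition itinerary (I : Type) (X : T -> I) (n : nat) (x : T) :
  {ffun 'I_n -> I} := [ffun i : 'I_n => X (iter i f x)].

Lemma finitely_valued_preimage (I : finType) (X : T -> I) :
  finitely_valued X -> finitely_valued (X \o f).
Proof. by move=> mX i; have := mf measurableT (mX i); rewrite setTI. Qed.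

Lemma finitely_valued_iter (I : finType) (X : T -> I) n :
  finitely_valued X -> finitely_valued (fun x => X (iter n f x)).
Proof.
elim: n X => [//|n IHn] X mX.
exact: (IHn (X \o f) (finitely_valued_preimage mX)).
Qed.

Lemma law_iter (I : finType) (X : T -> I) n i : finitely_valued X ->
  law nu (fun x => X (iter n f x)) i = law nu X i.
Proof.
elim: n X => [//|n IHn] X mX.
rewrite (IHn (X \o f)); last exact: finitely_valued_preimage.
by rewrite /law /prob -(inv (mX i)).
Qed.

Lemma finitely_valued_itinerary (I : finType) (X : T -> I) n :
  finitely_valued X -> finitely_valued (itinerary X n).
Proof.
by move=> mX; apply: finitely_valued_ffun => i; exact: finitely_valued_iter.
Qed.

(** Each further step of the itinerary is compared with the kernel applied to
    the current state; by stationarity every step costs the same. *)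
Lemma itinerary_entropy_le (I : finType) (X : T -> I) (K : I -> I -> R) n :
  finitely_valued X ->
  (forall i j, 0 <= K i j) -> (forall i, \sum_j K i j <= 1) ->
  (forall z, 0 < law nu (fun x => (X x, X (f x))) z -> 0 < K z.1 z.2) ->
  shannon nu (itinerary X n.+1) <= shannon nu (itinerary X 1)
    - n%:R * \sum_z law nu (fun x => (X x, X (f x))) z * ln (K z.1 z.2).
Proof.
move=> mX K0 K1 Kpos; elim: n => [|n IHn]; first by rewrite mul0r subr0.
set c := \sum_z _ in IHn *.
have mfX := finitely_valued_preimage mX.
have mXX := finitely_valued_pair mX mfX.
pose P := itinerary X n.+1.
pose Y x := X (iter n.+1 f x).
have mP : finitely_valued P by exact: finitely_valued_itinerary.
have mY : finitely_valued Y by exact: finitely_valued_iter.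
(* The longer itinerary is a function of the shorter one and the last state. *)
pose ext (z : {ffun 'I_n.+1 -> I} * I) : {ffun 'I_n.+2 -> I} :=
  [ffun i => if unlift ord_max i is Some j then z.1 j else z.2].
have -> : itinerary X n.+2 = ext \o (fun x => (P x, Y x)).
  apply/funext => x; apply/ffunP => i; rewrite !ffunE.
  by case: unliftP => [j ->|->]; rewrite ?lift_max// ffunE.
apply: le_trans (shannon_comp _ _ (finitely_valued_pair mP mY)) _.
pose last2 (z : {ffun 'I_n.+1 -> I} * I) := (z.1 ord_max, z.2).
have last2E : last2 \o (fun x => (P x, Y x))
            = fun x => (fun y => (X y, X (f y))) (iter n f x).
  by apply/funext => x; rewrite /last2/= ffunE.
have lawE z : law nu (last2 \o (fun x => (P x, Y x))) z
            = law nu (fun y => (X y, X (f y))) z.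
  by rewrite last2E; exact: (law_iter n z mXX).
have [|||le _] := @shannon_pair_leif _ _ _ nu _ _ P Y
  (fun p j => K (p ord_max) j) mP mY.
- by [].
- by [].
- move=> z z0; apply: (Kpos (last2 z)); rewrite -lawE.
  apply: lt_le_trans z0 _.
  exact: (@law_comp_ge _ _ _ _ _ _ _ last2 z (finitely_valued_pair mP mY)).
apply: le_trans le _.
rewrite -(@sum_law_comp _ _ _ nu _ _ _ last2 (fun z => ln (K z.1 z.2))
  (finitely_valued_pair mP mY)).
rewrite (eq_bigr _ (fun z _ => congr1 (fun t => t * _) (lawE z))) -/c.
by rewrite -natr1; lra.
Qed.

End itineraries.

(** * Entropy of an arbitrary finite partition *)

Lemma law_comp_gt0 (d : measure_display) (T : measurableType d) (R : realType)
    (nu : probability T R) (I J : finType) (X : T -> I) (h : I -> J) j :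
  finitely_valued X -> 0 < law nu (h \o X) j ->
  exists2 i, h i = j & 0 < law nu X i.
Proof.
move=> mX; rewrite law_comp// lt0r psumr_neq0; last first.
  by move=> i _; exact: law_ge0.
by case/andP => /hasP[i _ /andP[/eqP hi p]] _; exists i.
Qed.

Lemma law_gt0_inhabited (d : measure_display) (T : measurableType d)
    (R : realType) (nu : probability T R) (I : finType) (X : T -> I) i :
  0 < law nu X i -> exists x, X x = i.
Proof.
rewrite /law; have [->|/set0P[x Xx] _] := eqVneq (X @^-1` [set i]) set0.
  by rewrite /prob measure0/= ltxx.
by exists x.
Qed.

(** A sequence without a limit has [limn] equal to the default value 0; the
    condition 0 <= h covers that case. *)
Lemma limn_le_affine (R : realType) (u : R^nat) (C h : R) : 0 <= h ->
  (forall n, u n.+1 <= C + n.+1%:R * h) ->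
  limn (fun n => u n / n%:R) <= h.
Proof.
move=> h0 uC; have [cu|/dvgP ->//] := pselect (cvgn (fun n => u n / n%:R)).
apply/ler_addgt0Pr => e e0; apply: limr_le => //.
near=> n.
have n0 : (0 < n)%N by near: n; exact: nbhs_infty_gt.
have nR : 0 < n%:R :> R by rewrite ltr0n.
rewrite ler_pdivrMr//; move: (uC n.-1); rewrite prednK// => /le_trans; apply.
rewrite mulrDl (mulrC h) addrC lerD2l -ler_pdivrMl// mulrC.
by near: n; exact: nbhs_infty_ger.
Unshelve. all: by end_near.
Qed.

Lemma finitely_valued_label (d : measure_display) (T : measurableType d)
    (k : nat) (A : 'I_k -> set T) (l : T -> 'I_k) :
  (forall i, measurable (A i)) -> (forall x i, A i x <-> l x = i) ->
  finitely_valued l.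
Proof.
move=> mA Al i; rewrite (_ : _ @^-1` _ = A i)//.
by apply/seteqP; split=> x /= /Al.
Qed.

Lemma join_entropy_itinerary (d : measure_display) (T : measurableType d)
    (R : realType) (nu : probability T R) (f : T -> T) (k : nat)
    (A : 'I_k -> set T) (l : T -> 'I_k) n : (forall x i, A i x <-> l x = i) ->
  join_entropy nu f A n = shannon nu (itinerary f l n).
Proof.
move=> Al; rewrite /join_entropy /shannon; congr (- _); apply: eq_bigr => w _.
rewrite /law /prob (_ : itinerary_atom f A w = itinerary f l n @^-1` [set w])//.
apply/seteqP; split=> x /=.
  by move=> xw; apply/ffunP => i; rewrite ffunE; apply/Al.
by move=> <- i; apply/Al; rewrite ffunE.
Qed.

(** The label [l] of the partition is guessed from an auxiliary state [U] by the
    approximation [g], and [U] is updated by an innovation [Y] that the kernel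
    [psi] predicts from [U]. *)
Section partition_entropy_upper_bound.
Context (d : measure_display) (T : measurableType d) (R : realType).
Context (nu : probability T R) (f : T -> T).
Hypotheses (mf : measurable_fun setT f) (inv : invariant_measure f nu).
Context (k : nat) (A : 'I_k -> set T) (l : T -> 'I_k).
Hypotheses (mA : forall i, measurable (A i)).
Hypothesis Al : forall x i, A i x <-> l x = i.
Context (I J : finType) (U : T -> I) (Y : T -> J) (tau : I -> J -> I).
Hypotheses (mU : finitely_valued U) (mY : finitely_valued Y).
Hypothesis tauE : forall x, U (f x) = tau (U x) (Y x).
Context (psi : I -> J -> R).
Hypothesis psi_ge0 : forall u b, 0 <= psi u b.
Hypothesis psi_le1 : forall u, \sum_b psi u b <= 1.
Hypothesis psi_gt0 :
  forall z, 0 < law nu (fun x => (U x, Y x)) z -> 0 < psi z.1 z.2.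
Context (g : I -> 'I_k) (M e : R).
Hypothesis g_approx : prob nu [set x | l x != g (U x)] <= e.
Hypothesis M_ge0 : 0 <= M.

Let mL : finitely_valued l := finitely_valued_label mA Al.

(** The factor exp (- k exp (- M)) normalizes the label weights, which are 1 for
    the guessed label and exp (- M) for each of the others. *)
Let kernel (s s' : 'I_k * I) : R :=
  (\sum_(b | tau s.2 b == s'.2) psi s.2 b) *
  expR (- (M * (s'.1 != g s'.2)%:R) - k%:R * expR (- M)).

Let kernel_le1 s : \sum_s' kernel s s' <= 1.
Proof.
rewrite -(pair_bigA _ (fun a u => kernel s (a, u)))/= exchange_big/=.
apply: le_trans (_ : \sum_u \sum_(b | tau s.2 b == u) psi s.2 b <= _).
  apply: ler_sum => u _; rewrite /kernel/= -mulr_sumr ler_piMr ?sumr_ge0//.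
  under eq_bigr do rewrite expRD; rewrite -mulr_suml.
  rewrite -ler_pdivlMr ?expR_gt0// -expRN opprK mul1r.
  apply: le_trans (expR_ge1Dx _).
  rewrite (bigD1 (g u))//= eqxx mulr0 oppr0 expR0.
  rewrite lerD2l (eq_bigr (fun=> expR (- M))); last first.
    by move=> i /= /negbTE ->; rewrite mulr1.
  rewrite sumr_const -[leLHS]mulr_natl ler_pM2r ?expR_gt0// ler_nat.
  by rewrite (leq_trans (max_card _))// card_ord.
rewrite (exchange_big_dep predT)//=.
apply: le_trans (psi_le1 s.2); apply: ler_sum => b _.
by rewrite (big_pred1 (tau s.2 b))// => u /=; rewrite eq_sym.
Qed.

Let S x := (l x, U x).
Let mS : finitely_valued S. Proof. exact: finitely_valued_pair. Qed.
Let Z x := (S x, (Y x, S (f x))).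
Let mZ : finitely_valued Z.
Proof.
apply: finitely_valued_pair => //; apply: finitely_valued_pair => //.
exact: finitely_valued_preimage.
Qed.

Let kernel_ge_psi z : 0 < law nu Z z ->
  0 < psi z.1.2 z.2.1 <= \sum_(b | tau z.1.2 b == z.2.2.2) psi z.1.2 b.
Proof.
move=> z0; have [x xz] := law_gt0_inhabited z0.
rewrite (bigD1 z.2.1)/=; last by rewrite -xz /= tauE.
rewrite lerDl sumr_ge0// andbT.
apply: (psi_gt0 (z := (z.1.2, z.2.1))); apply: lt_le_trans z0 _.
pose p (z : ('I_k * I) * (J * ('I_k * I))) := (z.1.2, z.2.1).
exact: (law_comp_ge nu p z mZ).
Qed.

Let kernel_ge0 s s' : 0 <= kernel s s'.
Proof. by rewrite mulr_ge0 ?expR_ge0// sumr_ge0. Qed.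

Let kernel_gt0 z :
  0 < law nu (fun x => (S x, S (f x))) z -> 0 < kernel z.1 z.2.
Proof.
move=> z0.
have [|y yz /kernel_ge_psi/andP[psi0 psi_le]] :=
  @law_comp_gt0 _ _ _ nu _ _ Z (fun z => (z.1, z.2.2)) z mZ; first exact: z0.
by rewrite -yz mulr_gt0 ?expR_gt0// (lt_le_trans psi0).
Qed.

Let rate : R :=
  - \sum_z law nu (fun x => (U x, Y x)) z * ln (psi z.1 z.2)
  + M * e + k%:R * expR (- M).

Let rate_ge0 : 0 <= rate.
Proof.
apply: addr_ge0; last by apply: mulr_ge0; [exact: ler0n|exact: expR_ge0].
apply: addr_ge0; last first.
  by apply: mulr_ge0 => //; exact: le_trans (prob_ge0 _ _) g_approx.
rewrite -sumrN sumr_ge0// => z _; rewrite -mulrN mulr_ge0 ?law_ge0// oppr_ge0.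
rewrite ln_le0// (le_trans _ (psi_le1 z.1))// (bigD1 z.2)//= lerDl.
exact: sumr_ge0.
Qed.

Let kernel_rate :
  - \sum_z law nu (fun x => (S x, S (f x))) z * ln (kernel z.1 z.2) <= rate.
Proof.
pose p (z : ('I_k * I) * (J * ('I_k * I))) := (z.1, z.2.2).
pose F z := ln (kernel z.1 z.2).
rewrite (sum_law_comp nu p F mZ).
pose G (z : ('I_k * I) * (J * ('I_k * I))) :=
  ln (psi z.1.2 z.2.1) - (M * (z.2.2.1 != g z.2.2.2)%:R + k%:R * expR (- M)).
have le_GF : \sum_z law nu Z z * G z <= \sum_z law nu Z z * F (p z).
  apply: ler_sum_law => z /kernel_ge_psi/andP[psi0 psi_le].
  have K0 := lt_le_trans psi0 psi_le.
  rewrite /G /F /p /kernel/= lnM ?posrE ?expR_gt0// expRK opprD.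
  by rewrite lerD2r ler_ln ?posrE.
rewrite (le_trans (_ : _ <= - \sum_z law nu Z z * G z)) ?lerN2// /rate.
rewrite /G; under eq_bigr do rewrite mulrBr mulrDr mulrCA.
rewrite sumrB big_split/= -mulr_suml sum_law// mul1r -mulr_sumr.
pose p1 (z : ('I_k * I) * (J * ('I_k * I))) := (z.1.2, z.2.1).
rewrite -(@sum_law_comp _ _ _ nu _ _ Z p1 (fun z => ln (psi z.1 z.2)) mZ).
pose p2 (z : ('I_k * I) * (J * ('I_k * I))) := z.2.2.
rewrite -(@sum_law_comp _ _ _ nu _ _ Z p2 (fun z => (z.1 != g z.2)%:R) mZ).
rewrite opprB [leLHS]addrC addrA lerD2r lerD2l ler_wpM2l//.
apply: le_trans g_approx.
rewrite (@prob_pred _ _ _ nu _ S (fun s => s.1 != g s.2) mS).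
rewrite [leRHS]big_mkcond/=; apply: ler_sum => s _.
rewrite (law_iter mf inv 1 s mS).
by case: ifP; rewrite ?mulr1 ?mulr0.
Qed.

(** The innovation costs the mean of - ln psi, and the label only
    M e + k exp (- M), which is small for M large and then e small. *)
Lemma partition_entropy_le : partition_entropy nu f A <= rate.
Proof.
apply: (@limn_le_affine _ _ (shannon nu (itinerary f S 1))) => // n.
rewrite (join_entropy_itinerary _ _ _ Al).
pose labels (p : {ffun 'I_n.+1 -> 'I_k * I}) := [ffun i => (p i).1].
have -> : itinerary f l n.+1 = labels \o itinerary f S n.+1.
  by apply/funext => x; apply/ffunP => i; rewrite !ffunE.
have mSn := @finitely_valued_itinerary _ _ f mf _ S n.+1 mS.
apply: le_trans (shannon_comp nu labels mSn) _.
apply: le_trans (itinerary_entropy_le mf inv n mS kernel_ge0 kernel_le1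
  kernel_gt0) _.
rewrite lerD2l -mulrN; apply: le_trans (ler_wpM2l _ kernel_rate) _ => //.
by rewrite ler_wpM2r// ler_nat.
Qed.

End partition_entropy_upper_bound.

(** * Approximation by events on finite windows *)

Lemma measurable_coordinate (i : int) (b : bool) :
  measurable ([set x | x i = b] : set config).
Proof. by apply: sub_sigma_algebra; exists i, b. Qed.

Lemma finitely_valued_coordinate (i : int) :
  finitely_valued (fun x : config => x i).
Proof. by move=> b; exact: measurable_coordinate. Qed.

Lemma measurable_fun_config (d : measure_display) (T : measurableType d)
    (F : T -> config) :
  (forall i b, measurable [set x | F x i = b]) -> measurable_fun setT F.
Proof.
move=> mF; apply: (@measurability _ _ T config setT F coordinate_events erefl).
by move=> _ [_ [i [b ->]] <-]; rewrite setTI; exact: mF.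
Qed.

(** Events decided by the letters at distance at most [m] from the origin,
    phrased without reference to words, so that closure under Boolean operations
    and monotonicity in [m] are immediate. *)
Definition local_event (m : nat) (B : set config) : Prop :=
  forall x y : config,
    (forall i : int, `|i| <= m%:Z -> x i = y i) -> B x -> B y.

Definition window (m : nat) (x : config) : {ffun 'I_(m.*2.+1) -> bool} :=
  [ffun i : 'I_(m.*2.+1) => x ((i : nat)%:Z - m%:Z)].

(** Outside the window the letters are arbitrary: there [absz] and [inord] only
    make the function total. *)
Definition unwindow (m : nat) (u : {ffun 'I_(m.*2.+1) -> bool}) : config :=
  fun i : int => u (inord (absz (i + m%:Z))).

Lemma windowK m (x : config) i : `|i| <= m%:Z -> unwindow (window m x) i = x i.
Proof.
move=> im; rewrite /unwindow /window ffunE inordK; last by lia.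
by congr x; lia.
Qed.

Lemma finitely_valued_window m : finitely_valued (window m).
Proof.
apply: finitely_valued_ffun => i; exact: finitely_valued_coordinate.
Qed.

Lemma local_eventE m (B : set config) : local_event m B ->
  B = [set x | `[< B (unwindow (window m x)) >]].
Proof.
move=> lB; apply/seteqP; split=> x.
  by move=> Bx; apply/asboolP; apply: lB Bx => i im; rewrite windowK.
by move=> /asboolP; apply: lB => i im; rewrite windowK.
Qed.

Lemma measurable_local_event m (B : set config) :
  local_event m B -> measurable B.
Proof.
move=> /local_eventE ->.
exact: (@finitely_valued_pred _ _ _ _ (fun u => `[< B (unwindow u) >])
          (@finitely_valued_window m)).
Qed.

Lemma local_event_le m n (B : set config) : (m <= n)%N ->
  local_event m B -> local_event n B.
Proof.
by move=> mn lB x y xy; apply: lB => i im; apply: xy; rewrite (le_trans im).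
Qed.

Lemma local_eventC m (B : set config) : local_event m B -> local_event m (~` B).
Proof. by move=> lB x y xy nBx By; apply: nBx; apply: lB By => i /xy. Qed.

Lemma local_eventU m (B C : set config) :
  local_event m B -> local_event m C -> local_event m (B `|` C).
Proof. by move=> lB lC x y xy [/lB|/lC] h; [left|right]; apply: h. Qed.

Lemma local_eventI m (B C : set config) :
  local_event m B -> local_event m C -> local_event m (B `&` C).
Proof. by move=> lB lC x y xy [/lB h /lC h']; split; [apply: h|apply: h']. Qed.

Section approximation.
Context (R : realType) (nu : probability config R).

Definition approximable (A : set config) : Prop :=
  measurable A /\ forall e : R, 0 < e -> exists m (B : set config),
    local_event m B /\ prob nu ((A `\` B) `|` (B `\` A)) <= e.

Lemma approximable_local m B : local_event m B -> approximable B.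
Proof.
move=> lB; split=> [|e e0]; first exact: measurable_local_event lB.
exists m, B; split=> //; rewrite setDv setU0 /prob measure0/=; exact: ltW.
Qed.

Lemma approximableC A : approximable A -> approximable (~` A).
Proof.
move=> [mA aA]; split=> [|e /aA[m [B [lB AB]]]]; first exact: measurableC.
exists m, (~` B); split; first exact: local_eventC.
by rewrite !setDE !setCK setUC (setIC (~` B)) (setIC (~` A)) -!setDE.
Qed.

Lemma approximableU A A' :
  approximable A -> approximable A' -> approximable (A `|` A').
Proof.
move=> [mA aA] [mA' aA']; split=> [|e e0]; first exact: measurableU.
have e2 : 0 < e / 2 by rewrite divr_gt0.
have [m [B [lB AB]]] := aA _ e2.
have [m' [B' [lB' AB']]] := aA' _ e2.
exists (maxn m m'), (B `|` B'); split.
  by apply: local_eventU; [apply: local_event_le lB|apply: local_event_le lB'];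
    rewrite ?leq_maxl ?leq_maxr.
have mB := measurable_local_event lB; have mB' := measurable_local_event lB'.
rewrite [leRHS]splitr; apply: le_trans (lerD AB AB').
apply: le_trans (prob_setU _ _ _); last 2 first.
- by apply: measurableU; exact: measurableD.
- by apply: measurableU; exact: measurableD.
apply: le_prob.
- by apply: measurableU; apply: measurableD; exact: measurableU.
- by do 2 apply: measurableU; exact: measurableD.
move=> x [[[Ax|Ax] nB]|[[Bx|Bx] nA]].
- by left; left; split=> // Bx; apply: nB; left.
- by right; left; split=> // Bx; apply: nB; right.
- by left; right; split=> // Ax; apply: nA; left.
- by right; right; split=> // Ax; apply: nA; right.
Qed.

(** Continuity from below replaces the countable union by a finite one, up to
    half of the error. *)
Lemma approximable_bigcup (A : (set config)^nat) :
  (forall n, approximable (A n)) -> approximable (\bigcup_n A n).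
Proof.
move=> aA; pose F n := \big[setU/set0]_(i < n) A i.
have aF n : approximable (F n).
  rewrite /F; elim: n => [|n IHn]; last first.
    by rewrite big_ord_recr; exact: approximableU.
  by rewrite big_ord0; apply: (@approximable_local 0).
have mF n : measurable (F n) by have [] := aF n.
have mA : measurable (\bigcup_n A n).
  by apply: bigcupT_measurable => n; have [] := aA n.
split=> // e e0; have e2 : 0 < e / 2 by rewrite divr_gt0.
have FA : \bigcup_n F n = \bigcup_n A n.
  apply/seteqP; split=> x [n _].
    by rewrite /F -bigcup_mkord => -[i /= _ Aix]; exists i.
  by move=> Anx; exists n.+1 => //; rewrite /F big_ord_recr; right.
have F_cvg : (prob nu \o F) x @[x --> \oo] --> prob nu (\bigcup_n A n).
  apply: fine_cvg; rewrite -/(prob _ _) probE// -FA.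
  apply: nondecreasing_cvg_mu => //; first by rewrite FA.
  move=> m n mn; apply/subsetPset; rewrite /F -!bigcup_mkord.
  by move=> x [i /= im Aix]; exists i => //=; exact: leq_trans im mn.
have [n Fn] : exists n, prob nu (\bigcup_n A n) - prob nu (F n) <= e / 2.
  move/cvgrPdist_le : F_cvg => /(_ _ e2)[N _ /(_ N (leqnn N))] h.
  by exists N; apply: le_trans (ler_norm _) h.
have [_ /(_ _ e2)[m [B [lB FB]]]] := aF n.
have mB := measurable_local_event lB.
exists m, B; split=> //; rewrite [leRHS]splitr; apply: le_trans (lerD Fn FB).
have FsubA : F n `<=` \bigcup_n A n by rewrite -FA; exact: bigcup_sup.
have -> : prob nu (\bigcup_n A n) - prob nu (F n) =
    prob nu ((\bigcup_n A n) `\` F n).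
  apply: EFin_inj; rewrite EFinB !probE//; last exact: measurableD.
  by rewrite measureD ?setIidr// ltey_eq fin_num_measure.
apply: le_trans (prob_setU _ _ _); last 2 first.
- exact: measurableD.
- by apply: measurableU; exact: measurableD.
apply: le_prob.
- by apply: measurableU; exact: measurableD.
- by repeat apply: measurableU; exact: measurableD.
move=> x [[Ax nB]|[Bx nA]].
  have [Fx|nF] := pselect (F n x); last by left.
  by right; left.
by right; right; split=> // /FsubA.
Qed.

(** Approximable events form a sigma-algebra that contains the coordinate
    events. *)
Lemma measurable_approximable (A : set config) : measurable A -> approximable A.
Proof.
apply: smallest_sub.
  split.
  - by apply: (@approximable_local 0).
  - by move=> B; rewrite setTD; exact: approximableC.
  - exact: approximable_bigcup.
move=> _ [i [b ->]]; apply: (@approximable_local `|i|%N) => x y xy /= <-.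
by rewrite xy// abszE.
Qed.

End approximation.

(** * Entropy of the shift on binary sequences *)

Lemma prob_bigsetU (d : measure_display) (T : measurableType d) (R : realType)
    (nu : probability T R) (I : Type) (s : seq I) (F : I -> set T) :
  (forall i, measurable (F i)) ->
  prob nu (\big[setU/set0]_(i <- s) F i) <= \sum_(i <- s) prob nu (F i).
Proof.
move=> mF; elim: s => [|i s IHs].
  by rewrite !big_nil /prob measure0.
rewrite !big_cons; apply: le_trans (prob_setU _ _ _) _ => //.
  exact: bigsetU_measurable.
by rewrite lerD2l.
Qed.

Lemma partition_label (d : measure_display) (T : measurableType d) (k : nat)
    (A : 'I_k -> set T) : measurable_partition A ->
  exists l : T -> 'I_k, forall x i, A i x <-> l x = i.
Proof.
move=> [_ tA cA].
have /choice[l Al] (x : T) : exists i, A i x.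
  by have : setT x by []; rewrite -cA => -[i _ Aix]; exists i.
exists l => x i; split=> [Aix|<-//]; apply: tA => //.
by exists x.
Qed.

(** Each cell is approximated separately by an event on a window, and [g] picks
    the first cell whose approximation occurs. Off the symmetric differences
    exactly one approximation occurs, that of the true cell. *)
Lemma label_approx (R : realType) (nu : probability config R) (k : nat)
    (A : 'I_k -> set config) (l : config -> 'I_k) (e : R) :
  (forall i, measurable (A i)) -> (forall x i, A i x <-> l x = i) -> 0 < e ->
  exists m0, forall m, (m0 <= m)%N ->
    exists g : {ffun 'I_(m.*2.+1) -> bool} -> 'I_k,
      prob nu [set x | l x != g (window m x)] <= e.
Proof.
move=> mA Al e0; have i0 : 'I_k := l point.
have k0 : 0 < k%:R :> R by rewrite ltr0n; case: k i0 {mA Al A l} => [[]|].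
have ek : 0 < e / k%:R by rewrite divr_gt0.
have /choice[mB approxB] : forall i, exists mB : nat * set config,
    local_event mB.1 mB.2 /\
    prob nu ((A i `\` mB.2) `|` (mB.2 `\` A i)) <= e / k%:R.
  move=> i; have [_ /(_ _ ek)[m [B h]]] := measurable_approximable nu (mA i).
  by exists (m, B).
pose B i := (mB i).2.
have mBm i : measurable (B i) by have [/measurable_local_event] := approxB i.
exists (\max_i (mB i).1) => m m0.
have lB i : local_event m (B i).
  have [lB _] := approxB i; apply: local_event_le lB.
  by rewrite (leq_trans _ m0)// (leq_bigmax i).
exists (fun u => odflt i0 [pick i | `[< B i (unwindow u) >]]).
pose D := \big[setU/set0]_(i <- index_enum 'I_k)
  ((A i `\` B i) `|` (B i `\` A i)).
have mAB i : measurable ((A i `\` B i) `|` (B i `\` A i)).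
  by apply: measurableU; exact: measurableD.
apply: le_trans (_ : prob nu D <= _); last first.
  apply: le_trans (prob_bigsetU _ _ mAB) _.
  apply: le_trans (ler_sum _ (fun i _ => (approxB i).2)) _.
  by rewrite sumr_const card_ord -[X in X <= _]mulr_natr divfK ?gt_eqF.
have ml := finitely_valued_label mA Al.
apply: le_prob.
- have mlw := finitely_valued_pair ml (@finitely_valued_window m).
  exact: (@finitely_valued_pred _ _ _ _
    (fun z => z.1 != odflt i0 [pick i | `[< B i (unwindow z.2) >]]) mlw).
- exact: bigsetU_measurable.
have inB x i : B i (unwindow (window m x)) <-> B i x.
  by split; apply: lB => j jm; rewrite windowK.
move=> x /= lx; apply: contrapT => nDx.
have AB i : A i x <-> B i x.
  split=> h; apply: contrapT => nh; apply: nDx; rewrite /D.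
    by rewrite (bigD1 i)//=; left; left.
  by rewrite (bigD1 i)//=; left; right.
move/negP: lx; apply; case: pickP => [i /asboolP/inB/AB/Al ->//|/(_ (l x))].
by move/asboolP; case; apply/inB/AB/Al.
Qed.

Lemma measurable_shift_minus : measurable_fun setT shift_minus.
Proof.
apply: (@measurable_fun_config _ config shift_minus) => i b.
exact: measurable_coordinate.
Qed.

Lemma iter_shift_minus n (x : config) : iter n shift_minus x = translate n x.
Proof.
elim: n => [|n IHn].
  by apply/funext => i; rewrite /= /translate addr0.
rewrite iterS IHn; apply/funext => i; rewrite /shift_minus /translate.
by congr x; lia.
Qed.

Definition word (n : nat) (x : config) : {ffun 'I_n -> bool} :=
  [ffun i : 'I_n => x (i : nat)%:Z].

Lemma finitely_valued_word n : finitely_valued (word n).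
Proof.
by apply: finitely_valued_ffun => i; exact: finitely_valued_coordinate.
Qed.

Lemma law_coordinate (R : realType) (nu : probability config R) (k : nat) b :
  invariant_measure shift_minus nu ->
  law nu (fun x : config => x k%:Z) b = law nu (fun x : config => x 0) b.
Proof.
move=> inv; have m0 := finitely_valued_coordinate 0.
rewrite -(law_iter measurable_shift_minus inv k b m0).
congr law; apply/funext => x; rewrite iter_shift_minus /translate.
by congr x; lia.
Qed.

Definition next_letter (n : nat) (x : config) : {ffun 'I_n -> bool} * bool :=
  (word n x, x n%:Z).

Lemma finitely_valued_next_letter n : finitely_valued (next_letter n).
Proof.
exact: (finitely_valued_pair (@finitely_valued_word n)
                             (finitely_valued_coordinate n%:Z)).
Qed.

(** The auxiliary state is a window long enough both to guess the label of the
    partition and to contain the [N] letters that [psi] looks at. Shifting the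
    window reveals the one letter to its right. *)
Lemma ks_entropy_le (R : realType) (nu : probability config R) (N : nat)
    (psi : {ffun 'I_N -> bool} -> bool -> R) :
  invariant_measure shift_minus nu ->
  (forall u b, 0 <= psi u b) -> (forall u, \sum_b psi u b <= 1) ->
  (forall z, 0 < law nu (next_letter N) z -> 0 < psi z.1 z.2) ->
  (ks_entropy nu shift_minus <=
    (- \sum_z law nu (next_letter N) z * ln (psi z.1 z.2))%:E)%E.
Proof.
move=> inv psi0 psi1 psi_gt0; apply: ge_ereal_sup => _ [k [A [pA ->]]].
rewrite lee_fin; apply/ler_addgt0Pr => e e0.
have mA : forall i, measurable (A i) by case: pA.
have [l Al] := partition_label pA.
have e2 : 0 < e / 2 by rewrite divr_gt0.
(* With this a, k exp (- ln a) = k / a is at most e / 2. *)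
pose a : R := k%:R * (e / 2)^-1 + 1.
have a1 : 1 <= a by rewrite lerDr mulr_ge0// invr_ge0 ltW.
have a0 : 0 < a := lt_le_trans ltr01 a1.
pose M := ln a.
have M0 : 0 <= M by rewrite ln_ge0.
have kM : k%:R * expR (- M) <= e / 2.
  rewrite expRN lnK ?posrE// ler_pdivrMr// mulrDr mulr1 mulrCA divff ?gt_eqF//.
  by rewrite mulr1 lerDl ltW.
have eM : 0 < e / 2 / (M + 1) by rewrite divr_gt0// ltr_wpDl.
have [m0 approx] := label_approx nu mA Al eM.
pose m := maxn m0 N.
have [g g_approx] := approx m (leq_maxl _ _).
have Nm : (N <= m)%N := leq_maxr _ _.
pose tau (u : {ffun 'I_(m.*2.+1) -> bool}) (b : bool) :
    {ffun 'I_(m.*2.+1) -> bool} :=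
  [ffun i : 'I_(m.*2.+1) => if (i < m.*2)%N then u (inord i.+1) else b].
pose Y (x : config) := x (m.+1%:Z).
have tauE x : window m (shift_minus x) = tau (window m x) (Y x).
  apply/ffunP => i; rewrite !ffunE /shift_minus /Y.
  have := ltn_ord i; case: ifP => im i_lt; last by congr x; lia.
  by rewrite inordK; [congr x; lia|lia].
pose lastN (u : {ffun 'I_(m.*2.+1) -> bool}) : {ffun 'I_N -> bool} :=
  [ffun i : 'I_N => u (inord (m.*2.+1 - N + i))].
pose h (z : {ffun 'I_(m.*2.+1) -> bool} * bool) := (lastN z.1, z.2).
pose WY (x : config) := (window m x, Y x).
have mY : finitely_valued Y by exact: finitely_valued_coordinate.
have mWY : finitely_valued WY :=
  finitely_valued_pair (@finitely_valued_window m) mY.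
(* The last N letters of the window and the letter after it are the first N + 1
   letters of a shifted configuration. *)
have hE : h \o WY = fun x => next_letter N (iter (m.+1 - N) shift_minus x).
  apply/funext => x; rewrite /h /WY /next_letter iter_shift_minus /=.
  congr (_, _).
    apply/ffunP => i; rewrite !ffunE /translate; have := ltn_ord i => iN.
    by rewrite inordK; [congr x; lia|lia].
  by rewrite /Y /translate; congr x; lia.
have lawE z : law nu (h \o WY) z = law nu (next_letter N) z.
  rewrite hE; apply: (law_iter measurable_shift_minus inv).
  exact: finitely_valued_next_letter.
have psi_gt0' z : 0 < law nu WY z -> 0 < psi (lastN z.1) z.2.
  move=> z0; apply: (psi_gt0 (h z)); rewrite -lawE.
  exact: lt_le_trans z0 (law_comp_ge nu h z mWY).
have := partition_entropy_le measurable_shift_minus inv mA Al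
  (@finitely_valued_window m) mY tauE (fun u b => psi0 (lastN u) b)
  (fun u => psi1 (lastN u)) psi_gt0' g_approx M0.
move/le_trans; apply.
rewrite -addrA lerD//.
  rewrite lerN2.
  under [leLHS]eq_bigr do rewrite -lawE.
  by rewrite (sum_law_comp nu h (fun z => ln (psi z.1 z.2)) mWY).
rewrite [leRHS]splitr lerD// mulrA ler_pdivrMr ?ltr_wpDl//.
by rewrite mulrDr mulr1 mulrC lerDl ltW.
Qed.

(** * Equality of measures and transport by conjugacies *)

Lemma same_measure_window (R : realType) (nu mu : probability config R) :
  (forall m u, law nu (window m) u = law mu (window m) u) -> same_measure nu mu.
Proof.
move=> numu.
apply: (measure_unique [set B | exists m, local_event m B] (fun=> setT)).
- apply/seteqP; split; last first.
    apply: smallest_sub; first exact: sigma_algebra_measurable.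
    by move=> B [m /measurable_local_event].
  apply: sub_sigma_algebra2 => _ [i [b ->]]; exists `|i|%N => x y xy /= <-.
  by rewrite xy// abszE.
- move=> B C [m lB] [n lC]; exists (maxn m n).
  by apply: local_eventI; [apply: local_event_le lB|apply: local_event_le lC];
    rewrite ?leq_maxl ?leq_maxr.
- by move=> _; exists 0%N.
- by rewrite bigcup_const//; exists 0%N.
- move=> B [m lB]; have mB := measurable_local_event lB.
  suff e : prob nu B = prob mu B by move: (congr1 EFin e); rewrite !probE.
  rewrite (local_eventE lB).
  by rewrite !(@prob_pred _ _ _ _ _ (window m) (fun u => `[< B (unwindow u) >])
    (@finitely_valued_window m)); apply: eq_bigr.
- by move=> _; rewrite ltey_eq fin_num_measure.
Qed.

Lemma same_measure_word (R : realType) (nu mu : probability config R) :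
  invariant_measure shift_minus nu -> invariant_measure shift_minus mu ->
  (forall n u, law nu (word n.+1) u = law mu (word n.+1) u) ->
  same_measure nu mu.
Proof.
move=> inv inv' numu; apply: same_measure_window => m u.
have wordE : word m.*2.+1 = fun x => window m (iter m shift_minus x).
  apply/funext => x; apply/ffunP => i.
  by rewrite !ffunE iter_shift_minus /translate; congr x; lia.
have := numu m.*2 u; rewrite wordE.
have mw := @finitely_valued_window m.
rewrite (law_iter measurable_shift_minus inv m u mw).
by rewrite (law_iter measurable_shift_minus inv' m u mw).
Qed.

Lemma image_probability (d d' : measure_display) (T : measurableType d)
    (T' : measurableType d') (R : realType) (nu : probability T R)
    (F : T -> T') :
  measurable_fun setT F ->
  exists nu' : probability T' R, forall A, nu' A = nu (F @^-1` A).
Proof.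
by move=> mF; exists (distribution nu (mfun_Sub (mem_set mF))) => A.
Qed.

Section conjugacy.
Context (d d' : measure_display).
Context (T : measurableType d) (T' : measurableType d').
Context (R : realType) (f : T -> T) (f' : T' -> T') (F : T -> T').
Hypotheses (mF : measurable_fun setT F) (Ff : forall x, F (f x) = f' (F x)).

Lemma preimage_measurable A : measurable A -> measurable (F @^-1` A).
Proof. by move=> mA; have := mF measurableT mA; rewrite setTI. Qed.

Lemma invariant_image (nu : probability T R) (nu' : probability T' R) :
  (forall A, nu' A = nu (F @^-1` A)) ->
  invariant_measure f nu -> invariant_measure f' nu'.
Proof.
move=> nu'E inv A mA; rewrite !nu'E -(inv _ (preimage_measurable mA)).
by congr (nu _); apply/seteqP; split=> x /=; rewrite Ff.
Qed.

(** Every partition of a factor pulls back to a partition with the same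
    itinerary laws. *)
Lemma ks_entropy_factor (nu : probability T R) (nu' : probability T' R) :
  (forall A, nu' A = nu (F @^-1` A)) ->
  (ks_entropy nu' f' <= ks_entropy nu f)%E.
Proof.
move=> nu'E; apply: ge_ereal_sup => _ [k [A [[mA tA cA] ->]]].
apply: ereal_sup_ubound; exists k, (fun i => F @^-1` A i); split.
  split.
  - by move=> i; exact: preimage_measurable.
  - by move=> i j _ _ [x [/= Ai Aj]]; apply: tA => //; exists (F x).
  - by rewrite -preimage_bigcup cA preimage_setT.
congr EFin; rewrite /partition_entropy; congr (limn _); apply/funext => n.
congr (_ / _); rewrite /join_entropy; congr (- _); apply: eq_bigr => w _.
suff -> : nu' (itinerary_atom f' A w) =
          nu (itinerary_atom f (fun i => F @^-1` A i) w) by [].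
rewrite nu'E; congr (nu _).
have Fi n' x : F (iter n' f x) = iter n' f' (F x).
  by elim: n' => //= n' IHn; rewrite Ff IHn.
by apply/seteqP; split=> x /= h i; move: (h i); rewrite /preimage/= Fi.
Qed.

End conjugacy.

Section max_entropy_conjugacy.
Context (d d' : measure_display).
Context (T : measurableType d) (T' : measurableType d').
Context (R : realType) (f : T -> T) (f' : T' -> T').
Context (F : T -> T') (G : T' -> T).
Hypotheses (mF : measurable_fun setT F) (mG : measurable_fun setT G).
Hypotheses (FK : cancel F G) (GK : cancel G F).
Hypothesis Ff : forall x, F (f x) = f' (F x).
Context (B : set T) (B' : set T').
Hypothesis FB : F @^-1` B' = B.

Let Gf y : G (f' y) = f (G y).
Proof. by apply: (can_inj FK); rewrite GK Ff GK. Qed.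

Let GB : G @^-1` B = B'.
Proof. by rewrite -FB; apply/seteqP; split=> y /=; rewrite GK. Qed.

(** A conjugacy is a factor map in both directions, so it preserves entropy and
    carries the measures of each subsystem onto those of the other. *)
Lemma the_max_entropy_measure_conjugate (mu : probability T R)
    (mu' : probability T' R) : (forall A, mu' A = mu (F @^-1` A)) ->
  the_max_entropy_measure f B mu -> the_max_entropy_measure f' B' mu'.
Proof.
have back (nu : probability T R) (nu' : probability T' R) :
    (forall A, nu' A = nu (F @^-1` A)) -> forall A, nu A = nu' (G @^-1` A).
  move=> h A; rewrite h; congr (nu _).
  by apply/seteqP; split=> x /=; rewrite FK.
have sub (nu : probability T R) (nu' : probability T' R) :
    (forall A, nu' A = nu (F @^-1` A)) ->
    subsystem_measure f B nu <-> subsystem_measure f' B' nu'.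
  move=> h; split=> -[inv nuB]; split.
  - exact: invariant_image h inv.
  - by rewrite h FB.
  - exact: (invariant_image mG Gf (back _ _ h)).
  - by rewrite (back _ _ h) GB.
have ent (nu : probability T R) (nu' : probability T' R) :
    (forall A, nu' A = nu (F @^-1` A)) -> ks_entropy nu' f' = ks_entropy nu f.
  move=> h; apply/eqP; rewrite eq_le (ks_entropy_factor mF Ff h).
  by rewrite (ks_entropy_factor mG Gf (back _ _ h)).
have pull (nu' : probability T' R) : exists nu : probability T R,
    forall A, nu' A = nu (F @^-1` A).
  have [nu h] := image_probability nu' mG; exists nu => A; rewrite h.
  by congr (nu' _); apply/seteqP; split=> x /=; rewrite GK.
move=> mu'E [[muB mu_max] mu_unique]; split.
  split; first exact/(sub _ _ mu'E).
  move=> nu'; have [nu nu'E] := pull nu'; move=> /(sub _ _ nu'E) /mu_max.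
  by rewrite (ent _ _ nu'E) (ent _ _ mu'E).
move=> nu'; have [nu nu'E] := pull nu'; move=> [nuB nu_max] A mA.
rewrite nu'E mu'E; apply: mu_unique; last exact: preimage_measurable.
split; first exact/(sub _ _ nu'E).
move=> rho; have [rho' rho'E] := image_probability rho mF.
move=> /(sub _ _ rho'E)/nu_max.
by rewrite (ent _ _ nu'E) (ent _ _ rho'E).
Qed.

End max_entropy_conjugacy.

(** * A measure on binary sequences from consistent word weights *)

Definition cylinder_at (k : int) (w : seq bool) : set config :=
  [set x | forall j : nat, (j < size w)%N -> x (k + j%:Z) = nth false w j].

Lemma measurable_cylinder_at k w : measurable (cylinder_at k w).
Proof.
apply: (@measurable_local_event (`|k| + size w)) => x y xy xw j jw.
by rewrite -xw// xy//; lia.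
Qed.

Lemma prob_split_coordinate (R : realType) (mu : probability config R)
    (i : int) (A : set config) : measurable A ->
  prob mu A = \sum_b prob mu (A `&` [set x | x i = b]).
Proof.
move=> mA; have mAb b : measurable (A `&` [set x : config | x i = b]).
  by apply: measurableI => //; exact: measurable_coordinate.
apply: EFin_inj; rewrite big_bool/= EFinD !probE// -measureU//.
  congr (mu _); apply/seteqP; split=> x /=; last by case=> -[].
  by move=> Ax; case: (x i); [left|right].
by apply/seteqP; split=> // x /= [[_ ->] []].
Qed.

(** Consistent weights on words, that is, weights additive under extension by a
    letter on either side, are the cylinder probabilities of a measure. The unit
    interval is split into two intervals for the possible first letters, each of
    these according to the next letter, and so on, with lengths given by the
    weights; a point of the interval is sent to the configuration of the letters
    it meets. *)
Section extension.
Context (R : realType) (m : seq bool -> R).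
Hypothesis m_ge0 : forall w, 0 <= m w.
Hypothesis m_nil : m [::] = 1.
Hypothesis m_rcons : forall w, m w = m (rcons w false) + m (rcons w true).
Hypothesis m_cons : forall w, m w = m (false :: w) + m (true :: w).

(** Right and left extensions alternate, so that a word of length 2n + 1 fills
    the sites from - n to n. *)
Let extend (b : bool) (w : seq bool) : seq bool :=
  if odd (size w) then rcons w b else b :: w.

Let size_extend b w : size (extend b w) = (size w).+1.
Proof. by rewrite /extend; case: ifP => _ //; rewrite size_rcons. Qed.

Let extend_inj b b' v v' : extend b v = extend b' v' -> b = b' /\ v = v'.
Proof.
move=> e; have := congr1 size e; rewrite !size_extend => -[vv'].
move: e; rewrite /extend vv'; case: ifP => _ => [/rcons_inj|] [] -> -> //.
Qed.

Let extend_surj w : (0 < size w)%N -> exists b v, w = extend b v.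
Proof.
move=> w0; have [odd_w|odd_w] := boolP (odd (size w).-1).
  case/lastP: w odd_w w0 => // v b; rewrite size_rcons /= => odd_v _.
  by exists b, v; rewrite /extend odd_v.
case: w odd_w w0 => // b v /= odd_v _.
by exists b, v; rewrite /extend (negbTE odd_v).
Qed.

Let m_extend w : m w = m (extend false w) + m (extend true w).
Proof. by rewrite /extend; case: ifP => _; [exact: m_rcons|exact: m_cons]. Qed.

(** A state is the word of the current interval and its left endpoint. *)
Let step (t : R) (s : seq bool * R) : seq bool * R :=
  let p := m (extend false s.1) in
  if t < s.2 + p then (extend false s.1, s.2) else (extend true s.1, s.2 + p).

Let state (n : nat) (t : R) : seq bool * R := iter n (step t) ([::], 0).

Let step_size t s : size (step t s).1 = (size s.1).+1.
Proof. by rewrite /step; case: ifP => _; rewrite size_extend. Qed.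

Let size_state n t : size (state n t).1 = n.
Proof. by elim: n => //= n IHn; rewrite step_size IHn. Qed.

Let state_interval w : exists a : R, [/\ 0 <= a, a + m w <= 1 &
  forall t, 0 <= t < 1 ->
    ((state (size w) t).1 = w <-> a <= t < a + m w) /\
    ((state (size w) t).1 = w -> (state (size w) t).2 = a)].
Proof.
have [n] := ubnP (size w); elim: n w => // n IHn w.
have [w0 _|w0] := posnP (size w).
  exists 0; rewrite (size0nil w0) m_nil !add0r !lexx.
  split; [by []|by []|move=> t t01].
  by rewrite t01 /=; split=> // ; split.
have [b [v wE]] := extend_surj w0; rewrite wE size_extend ltnS => /IHn.
move=> [a [a0 a1 av]]; have mv := m_extend v.
exists (if b then a + m (extend false v) else a); split.
- by case: b {wE} => //; rewrite addr_ge0.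
- apply: le_trans a1; rewrite mv; case: b {wE}; first by rewrite addrA.
  by rewrite lerD2l lerDl.
move=> t t01; have [stv sta] := av t t01.
have -> : state (size v).+1 t = step t (state (size v) t) by [].
have sE : (step t (state (size v) t)).1 = extend b v <->
    (state (size v) t).1 = v /\ (t < a + m (extend false v)) = ~~ b.
  rewrite /step; case: ifPn => tlt; split.
  - move=> /extend_inj[eb ev]; split=> //.
    by move: tlt; rewrite ev -eb sta// => ->.
  - move=> [ev]; rewrite -(sta ev) -[in m _]ev tlt => eb.
    by rewrite -[b]negbK -eb ev.
  - move=> /extend_inj[eb ev]; split=> //.
    by move: tlt; rewrite ev -eb sta// => /negbTE ->.
  - move=> [ev]; rewrite -(sta ev) -[in m _]ev (negbTE tlt) => eb.
    by rewrite -[b]negbK -eb ev.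
split.
  apply: (iff_trans sE); split.
    move=> [/stv/andP[at1 t2] tb]; case: b tb {wE sE} => /= tb.
      by rewrite leNgt tb/= -addrA -mv.
    by rewrite at1 tb.
  have m0 := m_ge0 (extend false v); have m1 := m_ge0 (extend true v).
  case: b {wE sE} => /andP[t1 t2]; split.
  - by apply/stv; apply/andP; split; lra.
  - by apply/negbTE; rewrite -leNgt.
  - by apply/stv; apply/andP; split; lra.
  - by rewrite t2.
move=> /sE[ev tb]; rewrite /step (sta ev) ev tb.
by case: b {wE sE tb}.
Qed.

(** Only the points of [0, 1[ matter; sending the others to 0 gives a map on the
    whole line. *)
Let clamp (t : R) : R := if 0 <= t < 1 then t else 0.

(** The letter at site i is read from the first centred word that contains that
    site; later words extend it ([process_nth]). *)
Let process (t : R) : config :=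
  fun i => nth false (state (`|i|%N.*2.+1) (clamp t)).1 (absz (i + `|i|%N%:Z)).

Let process_nth t n i : `|i| <= n%:Z ->
  process t i = nth false (state n.*2.+1 (clamp t)).1 (absz (i + n%:Z)).
Proof.
move=> i_n; have -> : n = (`|i| + (n - `|i|))%N by lia.
elim: (n - `|i|)%N => [|k IHk]; first by rewrite addn0.
rewrite {}IHk addnS doubleS; set c := (_ + k)%N.
have -> : state c.*2.+3 (clamp t)
        = step (clamp t) (step (clamp t) (state c.*2.+1 (clamp t))) by [].
set s := state _ _; have sz : size s.1 = c.*2.+1 by rewrite size_state.
have stepE r : exists b, (step (clamp t) r).1 = extend b r.1.
  by rewrite /step; case: ifP => _; eexists; reflexivity.
have [b1 e1] := stepE s; have [b2 ->] := stepE (step (clamp t) s).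
rewrite e1 /extend sz /= odd_double/= size_rcons sz/= odd_double/=.
have -> : absz (i + c.+1%:Z) = (absz (i + c%:Z)).+1 by lia.
rewrite /= nth_rcons sz ifT//; lia.
Qed.

Let process_cylinder t w n : size w = n.*2.+1 ->
  cylinder_at (- n%:Z) w (process t) <-> (state (size w) (clamp t)).1 = w.
Proof.
move=> wn; split=> [tw|tw j jw].
  apply: (@eq_from_nth _ false); rewrite size_state// => j jw.
  rewrite -tw// (@process_nth _ n) ?wn; last by lia.
  by congr nth; lia.
rewrite (@process_nth _ n); last by lia.
by rewrite -wn tw; congr nth; lia.
Qed.

Let state_preimage w : exists a : R, [/\ 0 <= a, a + m w <= 1 &
  [set t | (state (size w) (clamp t)).1 = w] =
  `[a, a + m w[ `|` (~` `[0, 1[ `&` [set t | (state (size w) 0).1 = w])].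
Proof.
have [a [a0 a1 aw]] := state_interval w; exists a; split=> //.
have zero t : ~~ (0 <= t < 1) -> clamp t = 0 by rewrite /clamp => /negbTE ->.
apply/seteqP; split=> t.
  move=> tw; have [t01|t01] := boolP (0 <= t < 1).
    left; rewrite /= in_itv/=; move: tw; rewrite /= /clamp t01.
    by case: (aw t t01) => -[].
  right; split; first by rewrite /= in_itv/=; exact/negP.
  by move: tw; rewrite /= zero.
case=> [|[]]; rewrite /= in_itv/=.
  move=> t_in; have t01 : 0 <= t < 1.
    by case/andP: t_in => t1 t2; apply/andP; split; lra.
  by rewrite /clamp t01; have [[_ h] _] := aw t t01; exact: h.
by move=> /negP/zero ->.
Qed.

Let measurable_state w : measurable [set t | (state (size w) (clamp t)).1 = w].
Proof.
have [a [_ _ ->]] := state_preimage w.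
apply: measurableU => //; apply: measurableI; first exact: measurableC.
have [h|h] := pselect ((state (size w) 0).1 = w).
  by rewrite (_ : [set _ | _] = setT)//; apply/seteqP; split.
by rewrite (_ : [set _ | _] = set0)//; apply/seteqP; split.
Qed.

Let measurable_process : measurable_fun setT process.
Proof.
apply: measurable_fun_config => i b.
pose n := `|i|%N.*2.+1; pose c := absz (i + `|i|%N%:Z).
pose E (w : n.-tuple bool) : set R :=
  [set t | (state (size w) (clamp t)).1 = w].
rewrite (_ : [set t | _] =
    \bigcup_(w in [set w : n.-tuple bool | nth false w c = b]) E w).
  apply: fin_bigcup_measurable => [|w _]; first exact: finite_finset.
  exact: measurable_state.
apply/seteqP; split=> t.
  move=> tb; have sz := size_state n (clamp t).
  by exists (Tuple (introT eqP sz)) => //; rewrite /E /= sz.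
by move=> [w /= <-]; rewrite /E/= size_tuple /process -/n -/c => ->.
Qed.

Let uniform_interval (E : set R) (a b : R) :
  measurable E -> a <= b -> E `&` `[0, 1[ = `[a, b[%classic ->
  uniform_prob (@ltr01 R) E = (b - a)%:E.
Proof.
move=> mE ab EI.
have := @integral_uniform R 0 1 ltr01 (EFin \o \1_E).
rewrite subr0 invr1 mul1e integral_indic// setIT => ->.
- rewrite -integral_itv_bndo_bndc//; last first.
    by apply/measurable_EFinP; exact: measurable_indic.
  rewrite integral_indic// EI.
  apply: etrans (lebesgue_measure_itv `[a, b[) _; rewrite /= lte_fin.
  by case: ltgtP ab => // ->; rewrite subrr.
- exact/measurable_EFinP/measurable_indic.
- by move=> x; rewrite lee_fin.
Qed.

Lemma word_weights_extend : exists mu : probability config R,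
  forall k w, prob mu (cylinder_at k w) = m w.
Proof.
have [mu muE] := image_probability (uniform_prob (@ltr01 R)) measurable_process.
exists mu.
have base n w : size w = n.*2.+1 -> prob mu (cylinder_at (- n%:Z) w) = m w.
  move=> wn; rewrite /prob muE.
  rewrite (_ : _ @^-1` _ =
      [set t | (state (size w) (clamp t)).1 = w]); last first.
    by apply/seteqP; split=> t; rewrite /= process_cylinder.
  have [a [a0 a1 e]] := state_preimage w.
  have EI : [set t | (state (size w) (clamp t)).1 = w] `&` `[0, 1[
          = `[a, a + m w[%classic.
    rewrite e setIUl setIAC setICl set0I setU0; apply/setIidPl => t.
    by rewrite /= !in_itv/= => /andP[t1 t2]; apply/andP; split; lra.
  apply: etrans (congr1 fine (uniform_interval (measurable_state w) _ EI)) _.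
    by rewrite lerDl.
  by rewrite /= addrC addKr.
(* Any cylinder is reached from a centred one by erasing letters on both sides;
   erasing a letter is summation over its values. *)
have right k w : prob mu (cylinder_at k w)
    = \sum_b prob mu (cylinder_at k (rcons w b)).
  rewrite (prob_split_coordinate mu (k + (size w)%:Z)); last first.
    exact: measurable_cylinder_at.
  apply: eq_bigr => b _; congr prob; apply/seteqP; split=> x /=.
    move=> [xw xb] j; rewrite size_rcons nth_rcons ltnS leq_eqVlt.
    by case: ltngtP => // [jw _|-> _]; first exact: xw.
  move=> xwb; split=> [j jw|].
    by rewrite xwb ?size_rcons ?leqW// nth_rcons jw.
  by rewrite xwb ?size_rcons// nth_rcons ltnn eqxx.
have left k w : prob mu (cylinder_at (k + 1) w)
    = \sum_b prob mu (cylinder_at k (b :: w)).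
  rewrite (prob_split_coordinate mu k); last exact: measurable_cylinder_at.
  apply: eq_bigr => b _; congr prob; apply/seteqP; split=> x /=.
    move=> [xw xb] [_|j jw] /=; first by rewrite addr0.
    by rewrite -xw//; congr x; lia.
  move=> xwb; split=> [j jw|]; last by rewrite -[k]addr0 xwb.
  by have := xwb j.+1 jw; rewrite /= => <-; congr x; lia.
have shorten_right k n r :
    (forall w, size w = (n + r)%N -> prob mu (cylinder_at k w) = m w) ->
    forall w, size w = n -> prob mu (cylinder_at k w) = m w.
  elim: r n => [|r IHr] n h w wn; first by apply: h; rewrite addn0.
  rewrite right m_rcons big_bool [LHS]addrC.
  congr (_ + _); apply: (IHr n.+1) => [v vn|]; rewrite ?size_rcons ?wn//;
    by apply: h; lia.
have shorten_left k n r :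
    (forall w, size w = (n + r)%N -> prob mu (cylinder_at k w) = m w) ->
    forall w, size w = n -> prob mu (cylinder_at (k + r%:Z) w) = m w.
  elim: r n k => [|r IHr] n k h w wn.
    by rewrite addr0; apply: h; rewrite addn0.
  have -> : k + r.+1%:Z = (k + r%:Z) + 1 by lia.
  rewrite left m_cons big_bool [LHS]addrC.
  congr (_ + _); apply: (IHr n.+1 k) => [v vn|]; rewrite /= ?wn//;
    by apply: h; lia.
move=> k w; pose n := (`|k| + size w)%N.
have -> : k = - n%:Z + (absz (k + n%:Z))%:Z by lia.
apply: (shorten_left _ (size w) _ _ w erefl) => v vn.
apply: (shorten_right _ _ (n.*2.+1 - size v)%N _ v erefl) => u un.
by apply: base; lia.
Qed.

End extension.

(** * Parry weights of the golden mean shift *)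

Section markov_weights.
Context (R : realType) (pi : bool -> R) (t : bool -> bool -> R).

Fixpoint path_weight (a : bool) (w : seq bool) : R :=
  if w is b :: w' then t a b * path_weight b w' else 1.

Definition markov_weight (w : seq bool) : R :=
  if w is a :: w' then pi a * path_weight a w' else 1.

Hypotheses (pi_ge0 : forall a, 0 <= pi a) (t_ge0 : forall a b, 0 <= t a b).
Hypotheses (pi_sum : \sum_a pi a = 1) (t_sum : forall a, \sum_b t a b = 1).
Hypothesis pi_stationary : forall b, \sum_a pi a * t a b = pi b.

Lemma path_weight_ge0 a w : 0 <= path_weight a w.
Proof. by elim: w a => //= b w IHw a; rewrite mulr_ge0. Qed.

Lemma markov_weight_ge0 w : 0 <= markov_weight w.
Proof. by case: w => //= a w; rewrite mulr_ge0// path_weight_ge0. Qed.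

Lemma path_weight_cat a v w :
  path_weight a (v ++ w) = path_weight a v * path_weight (last a v) w.
Proof. by elim: v a => [|b v IHv] a /=; rewrite ?mul1r// IHv mulrA. Qed.

Lemma markov_weight_rcons a v b :
  markov_weight (rcons (a :: v) b) = markov_weight (a :: v) * t (last a v) b.
Proof. by rewrite /= -cats1 path_weight_cat/= mulr1 mulrA. Qed.

Lemma markov_weight_cat v b w :
  pi b * markov_weight (v ++ b :: w)
    = markov_weight (rcons v b) * markov_weight (b :: w).
Proof.
case: v => [|a v]; first by rewrite /= mulr1.
rewrite /= -cats1 !path_weight_cat/=; ring.
Qed.

Lemma markov_weight_split_right w :
  markov_weight w =
    markov_weight (rcons w false) + markov_weight (rcons w true).
Proof.
case: w => [|a w]; first by rewrite /= !mulr1 -pi_sum big_bool addrC.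
rewrite !markov_weight_rcons -mulrDr; have := t_sum (last a w).
by rewrite big_bool addrC => ->; rewrite mulr1.
Qed.

Lemma markov_weight_split_left w :
  markov_weight w = markov_weight (false :: w) + markov_weight (true :: w).
Proof.
case: w => [|b w]; first by rewrite /= !mulr1 -pi_sum big_bool addrC.
by rewrite /= !mulrA -mulrDl -(pi_stationary b) big_bool addrC.
Qed.

End markov_weights.

Section parry.
Context (R : realType).

(** The inverse of the golden mean, which is the growth rate of the number of
    words without two adjacent ones. *)
Definition inv_golden : R := (Num.sqrt 5 - 1) / 2.

Lemma inv_golden_gt0 : 0 < inv_golden.
Proof.
rewrite divr_gt0// subr_gt0 -[ltLHS]sqrtr1 ltr_sqrt//; lra.
Qed.

Lemma inv_golden_eq : inv_golden ^+ 2 = 1 - inv_golden.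
Proof.
have : Num.sqrt 5 ^+ 2 = 5 :> R by rewrite sqr_sqrtr.
rewrite /inv_golden; set q := Num.sqrt 5; lra.
Qed.

Local Notation s := inv_golden.

(** Perron eigenvector of the 0-1 matrix of allowed transitions. *)
Definition eigvec (b : bool) : R := if b then s else 1.

Definition parry_kernel (a b : bool) : R :=
  if a && b then 0 else s * eigvec b / eigvec a.

Definition parry_start (a : bool) : R := eigvec a ^+ 2 / (1 + s ^+ 2).

Lemma eigvec_gt0 b : 0 < eigvec b.
Proof. by case: b; rewrite /eigvec ?inv_golden_gt0. Qed.

Lemma parry_kernel_ge0 a b : 0 <= parry_kernel a b.
Proof.
rewrite /parry_kernel; case: ifP => // _; rewrite ltW// divr_gt0 ?eigvec_gt0//.
by rewrite mulr_gt0 ?eigvec_gt0// inv_golden_gt0.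
Qed.

Lemma parry_kernel_sum a : \sum_b parry_kernel a b = 1.
Proof.
have s0 : s != 0 by rewrite gt_eqF// inv_golden_gt0.
rewrite big_bool /parry_kernel.
case: a => /=; rewrite ?add0r ?mulr1 ?divr1 ?divff//.
by rewrite -expr2 inv_golden_eq subrK.
Qed.

Lemma one_add_sqr_gt0 : 0 < 1 + s ^+ 2.
Proof. by rewrite ltr_pwDl// sqr_ge0. Qed.

Lemma parry_start_ge0 a : 0 <= parry_start a.
Proof. by rewrite divr_ge0 ?sqr_ge0// ltW// one_add_sqr_gt0. Qed.

Lemma parry_start_sum : \sum_a parry_start a = 1.
Proof.
rewrite big_bool /parry_start/= -mulrDl expr1n addrC divff//.
by rewrite gt_eqF// one_add_sqr_gt0.
Qed.

Lemma parry_start_stationary b :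
  \sum_a parry_start a * parry_kernel a b = parry_start b.
Proof.
have s0 : s != 0 by rewrite gt_eqF// inv_golden_gt0.
have d0 : 1 + s ^+ 2 != 0 by rewrite gt_eqF// one_add_sqr_gt0.
rewrite big_bool /parry_start /parry_kernel; case: b => /=.
  by rewrite mulr0 add0r; field.
transitivity ((s ^+ 2 + s) / (1 + s ^+ 2)); first by field; rewrite d0 s0.
by congr (_ / _); rewrite inv_golden_eq subrK expr1n.
Qed.

Lemma parry_kernel_gt0 a b : (0 < parry_kernel a b) = ~~ (a && b).
Proof.
rewrite /parry_kernel; case: (a && b) => /=; first by rewrite ltxx.
have e0 := eigvec_gt0; have s0 := inv_golden_gt0.
by apply/idP; rewrite divr_gt0// mulr_gt0.
Qed.

(** The coboundary form responsible for maximality: up to a difference that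
    telescopes, all allowed transitions have the same weight. *)
Lemma ln_parry_kernel a b : ~~ (a && b) ->
  ln (parry_kernel a b) = ln s + ln (eigvec b) - ln (eigvec a).
Proof.
move=> /negbTE ab; rewrite /parry_kernel ab.
have e0 := eigvec_gt0; have s0 := inv_golden_gt0.
have se : 0 < s * eigvec b by exact: mulr_gt0.
by rewrite ln_div ?posrE// lnM ?posrE.
Qed.

End parry.

(** * Measures on the golden mean shift *)

Definition letters (n : nat) (u : {ffun 'I_n -> bool}) : seq bool :=
  [seq u i | i <- enum 'I_n].

Lemma size_letters n (u : {ffun 'I_n -> bool}) : size (letters u) = n.
Proof. by rewrite size_map size_enum_ord. Qed.

Lemma nth_letters n (u : {ffun 'I_n -> bool}) (i : 'I_n) :
  nth false (letters u) i = u i.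
Proof. by rewrite (nth_map i) ?size_enum_ord// nth_ord_enum. Qed.

Lemma ffun_eq_cylinder (k : int) n (u : {ffun 'I_n -> bool}) :
  [set x : config | [ffun i : 'I_n => x (k + (i : nat)%:Z)] = u]
    = cylinder_at k (letters u).
Proof.
apply/seteqP; split=> x /=.
  move=> <- j; rewrite size_letters => jn.
  by rewrite (nth_letters _ (Ordinal jn)) ffunE.
move=> xu; apply/ffunP => i.
by rewrite ffunE xu ?size_letters// nth_letters.
Qed.

Lemma law_window_cylinder (R : realType) (mu : probability config R) m u :
  law mu (window m) u = prob mu (cylinder_at (- m%:Z) (letters u)).
Proof.
rewrite -ffun_eq_cylinder; congr prob; apply/seteqP; split=> x /= <-;
  by apply/ffunP => i; rewrite !ffunE addrC.
Qed.

Lemma law_word_cylinder (R : realType) (mu : probability config R) n u :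
  law mu (word n) u = prob mu (cylinder_at 0 (letters u)).
Proof.
rewrite -ffun_eq_cylinder; congr prob; apply/seteqP; split=> x /= <-;
  by apply/ffunP => i; rewrite !ffunE add0r.
Qed.

Lemma law_next_letter_cylinder (R : realType) (mu : probability config R) n z :
  law mu (next_letter n) z = prob mu (cylinder_at 0 (rcons (letters z.1) z.2)).
Proof.
case: z => u b; congr prob; apply/seteqP; split=> x /=.
  move=> [<- <-] j; rewrite size_rcons nth_rcons size_letters ltnS add0r.
  rewrite leq_eqVlt; case: ltngtP => // [jn _|-> //].
  by rewrite (nth_letters _ (Ordinal jn)) ffunE.
move=> xub; congr (_, _).
  apply/ffunP => i; rewrite ffunE -[_%:Z]add0r.
  rewrite xub ?size_rcons ?size_letters ?leqW//.
  by rewrite nth_rcons size_letters ltn_ord nth_letters.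
rewrite -[_%:Z]add0r xub ?size_rcons ?size_letters//.
by rewrite nth_rcons size_letters ltnn eqxx.
Qed.

Definition init_last n (w : {ffun 'I_n.+1 -> bool}) :
  {ffun 'I_n -> bool} * bool :=
  ([ffun i : 'I_n => w (widen_ord (leqnSn n) i)], w ord_max).

Definition append n (z : {ffun 'I_n -> bool} * bool) : {ffun 'I_n.+1 -> bool} :=
  [ffun i => if unlift ord_max i is Some j then z.1 j else z.2].

Lemma init_last_word n : @init_last n \o word n.+1 = next_letter n.
Proof.
apply/funext => x; rewrite /init_last /next_letter /= ffunE; congr (_, _).
by apply/ffunP => i; rewrite !ffunE.
Qed.

Lemma append_next_letter n : @append n \o next_letter n = word n.+1.
Proof.
apply/funext => x; apply/ffunP => i; rewrite !ffunE.
by case: unliftP => [j ->|->]; rewrite ?lift_max// ffunE.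
Qed.

Lemma appendK n : cancel (@append n) (@init_last n).
Proof.
move=> [u b]; rewrite /init_last ffunE unlift_none; congr (_, _).
apply/ffunP => i; rewrite !ffunE.
have -> : widen_ord (leqnSn n) i = lift ord_max i.
  by apply: ord_inj; rewrite lift_max.
by rewrite liftK.
Qed.

Lemma init_lastK n : cancel (@init_last n) (@append n).
Proof.
move=> w; apply/ffunP => i; rewrite !ffunE; case: unliftP => [j ->|->//].
by rewrite ffunE; congr (w _); apply: ord_inj; rewrite lift_max.
Qed.

Lemma law_wordS (R : realType) (nu : probability config R) n w :
  law nu (word n.+1) w = law nu (next_letter n) (init_last w).
Proof.
rewrite -append_next_letter; congr prob; apply/seteqP; split=> x /= => [<-|->].
  by rewrite appendK.
exact: init_lastK.
Qed.

Lemma shannon_wordS (R : realType) (nu : probability config R) n :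
  shannon nu (word n.+1) = shannon nu (next_letter n).
Proof.
apply/eqP; rewrite eq_le; apply/andP; split.
  rewrite -append_next_letter.
  apply: (@shannon_comp _ _ _ nu _ _ (next_letter n) (@append n)).
  exact: finitely_valued_next_letter.
rewrite -init_last_word.
apply: (@shannon_comp _ _ _ nu _ _ (word n.+1) (@init_last n)).
exact: finitely_valued_word.
Qed.

Lemma measurable_B_plus : measurable B_plus.
Proof.
rewrite -[B_plus]setCK; apply: measurableC.
rewrite (_ : ~` _ = \bigcup_i [set x : config | x i && x (i + 1)]).
  apply: countable_bigcupT_measurable => [|i]; first exact: countableP.
  rewrite (_ : [set x | _] =
      [set x : config | x i = true] `&` [set x | x (i + 1) = true]).
    by apply: measurableI; exact: measurable_coordinate.
  by apply/seteqP; split=> x /= => [/andP[]|[-> ->]].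
apply/seteqP; split=> x /=.
  move/existsNP => [i /contrapT xi]; exists i => //=.
  by move: xi; case: (x i); case: (x _).
by move=> [i _ /= /andP[xi xi1]] /(_ i); rewrite xi xi1.
Qed.

Section golden_mean.
Context (R : realType).
Local Notation s := (inv_golden R).
Local Notation K := (@parry_kernel R).

Lemma golden_no_pair (nu : probability config R) n z : nu B_plus = 1%E ->
  0 < law nu (next_letter n.+1) z -> ~~ (z.1 ord_max && z.2).
Proof.
move=> nuB z0; apply: contraPN z0 => /andP[z1 z2]; apply/negP; rewrite -leNgt.
have -> : 0 = prob nu (~` B_plus) :> R.
  by rewrite /prob probability_setC ?nuB ?subee//; exact: measurable_B_plus.
apply: le_prob; first exact: finitely_valued_next_letter.
  apply: measurableC; exact: measurable_B_plus.
move=> x /= xz /(_ n%:Z); apply.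
move: z1 z2; rewrite -xz /= ffunE /= => ->.
have -> : n%:Z + 1 = n.+1%:Z by lia.
by move=> ->.
Qed.

(** By stationarity the coboundary part of the logarithm has mean 0. *)
Lemma parry_rate (nu : probability config R) n :
  subsystem_measure shift_minus B_plus nu ->
  \sum_z law nu (next_letter n.+1) z * ln (K (z.1 ord_max) z.2) = ln s.
Proof.
move=> [inv nuB].
have mN := @finitely_valued_next_letter n.+1.
rewrite (@eq_sum_law _ _ _ nu _ (next_letter n.+1) _ (fun z =>
    ln s + ln (eigvec R z.2) - ln (eigvec R (z.1 ord_max)))); last first.
  by move=> z /(golden_no_pair nuB); exact: ln_parry_kernel.
under eq_bigr do rewrite mulrBr mulrDr.
rewrite sumrB big_split/= -mulr_suml sum_law// mul1r.
pose new (z : {ffun 'I_n.+1 -> bool} * bool) := z.2.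
pose old (z : {ffun 'I_n.+1 -> bool} * bool) := z.1 ord_max.
rewrite -(sum_law_comp nu new (fun b => ln (eigvec R b)) mN).
rewrite -(sum_law_comp nu old (fun b => ln (eigvec R b)) mN).
have -> : old \o next_letter n.+1 = fun x : config => x n%:Z.
  by apply/funext => x; rewrite /old /= ffunE.
have -> : new \o next_letter n.+1 = fun x : config => x n.+1%:Z by [].
rewrite -addrA -sumrB big1 ?addr0// => b _.
by rewrite !law_coordinate// subrr.
Qed.

Lemma golden_entropy_le (nu : probability config R) :
  subsystem_measure shift_minus B_plus nu ->
  (ks_entropy nu shift_minus <= (- ln s)%:E)%E.
Proof.
move=> nuB; rewrite -(parry_rate 0 nuB).
apply: (@ks_entropy_le _ _ 1 (fun u b => K (u ord_max) b)).
- by case: nuB.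
- by move=> u b; exact: parry_kernel_ge0.
- by move=> u; rewrite parry_kernel_sum.
- by move=> z /(golden_no_pair nuB.2); rewrite parry_kernel_gt0.
Qed.

Definition parry_transitions (nu : probability config R) : Prop :=
  forall n z, law nu (next_letter n.+1) z
    = law nu (word n.+1) z.1 * K (z.1 ord_max) z.2.

Lemma parry_pair_leif (nu : probability config R) n :
  subsystem_measure shift_minus B_plus nu ->
  shannon nu (next_letter n.+1) <= shannon nu (word n.+1) - ln s
    ?= iff [forall z, law nu (next_letter n.+1) z
              == law nu (word n.+1) z.1 * K (z.1 ord_max) z.2].
Proof.
move=> nuB; rewrite -(parry_rate n nuB).
apply: (@shannon_pair_leif _ _ _ nu _ _ (word n.+1) (fun x => x n.+1%:Z)
  (fun u b => K (u ord_max) b)).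
- exact: finitely_valued_word.
- exact: finitely_valued_coordinate.
- by move=> u b; exact: parry_kernel_ge0.
- by move=> u; rewrite parry_kernel_sum.
- by move=> z /(golden_no_pair nuB.2); rewrite parry_kernel_gt0.
Qed.

(** [ks_entropy_le], with the conditional probabilities of [nu] as predictor,
    bounds the entropy of [nu] by the conditional entropy of the next letter.
    Maximality makes this conditional entropy attain its Parry bound. *)
Lemma max_entropy_parry_transitions (nu : probability config R) :
  subsystem_measure shift_minus B_plus nu ->
  ((- ln s)%:E <= ks_entropy nu shift_minus)%E -> parry_transitions nu.
Proof.
move=> nuB nu_max n z; have [inv _] := nuB.
have [_ equality_case] := parry_pair_leif n nuB.
suff /eqP : shannon nu (next_letter n.+1) = shannon nu (word n.+1) - ln s.
  by rewrite equality_case => /forallP/(_ z)/eqP.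
apply/eqP; rewrite eq_le (parry_pair_leif n nuB)/=.
pose p z := law nu (next_letter n.+1) z.
pose q u := law nu (word n.+1) u.
pose psi u b := p (u, b) / q u.
have mN := @finitely_valued_next_letter n.+1.
have mW := @finitely_valued_word n.+1.
have p_le_q z' : p z' <= q z'.1 := law_comp_ge nu fst z' mN.
have q_sum u : q u = \sum_b p (u, b).
  rewrite /q -[word n.+1]/(fst \o next_letter n.+1) law_comp//.
  rewrite (eq_bigl (fun z => z \in [pred z | z.1 == u]))//.
  rewrite (reindex_onto (fun b => (u, b)) snd) /=; last first.
    by move=> [u' b] /= /eqP <-.
  by apply: eq_bigl => b; rewrite inE/= !eqxx.
have psi_gt0 z' : 0 < p z' -> 0 < psi z'.1 z'.2.
  move=> pz; rewrite /psi -surjective_pairing divr_gt0//.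
  exact: lt_le_trans pz (p_le_q z').
have := le_trans nu_max (@ks_entropy_le _ nu n.+1 psi inv _ _ psi_gt0).
rewrite lee_fin => le_rate.
have -> : shannon nu (next_letter n.+1) = shannon nu (word n.+1)
    - \sum_z law nu (next_letter n.+1) z * ln (psi z.1 z.2).
  rewrite /shannon -[word n.+1]/(fst \o next_letter n.+1).
  rewrite (sum_law_comp nu fst
    (fun u => ln (law nu (fst \o next_letter n.+1) u)) mN).
  rewrite -opprD -big_split/=; congr (- _).
  under [RHS]eq_bigr do rewrite -mulrDr.
  apply: eq_sum_law => z' pz'; have qz' := lt_le_trans pz' (p_le_q z').
  rewrite /psi ln_div ?posrE -?surjective_pairing//.
  by rewrite addrC subrK.
rewrite lerD2l; apply: le_rate.
- by move=> u b; rewrite divr_ge0 ?law_ge0.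
- move=> u; rewrite -mulr_suml -q_sum.
  by have [->|qu] := eqVneq (q u) 0; rewrite ?mul0r ?divff.
Qed.

(** The transitions determine the law of words from the law of one letter, and
    stationarity determines the latter: the probability p of a one satisfies
    p = (1 - p) (1 - s). *)
Lemma parry_transitions_unique (nu mu : probability config R) :
  invariant_measure shift_minus nu -> invariant_measure shift_minus mu ->
  parry_transitions nu -> parry_transitions mu -> same_measure nu mu.
Proof.
move=> inv inv' tnu tmu; apply: same_measure_word => //.
have one_point (rho : probability config R) :
    invariant_measure shift_minus rho -> parry_transitions rho ->
    forall b, law rho (fun x : config => x 0) b
      = if b then (1 - s) / (2 - s) else 1 - (1 - s) / (2 - s).
  move=> rho_inv trho.
  have p_sum := sum_law rho (finitely_valued_coordinate 0).
  rewrite big_bool/= in p_sum.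
  pose first (u : {ffun 'I_1 -> bool}) := u ord_max.
  have firstE : first \o word 1 = fun x : config => x 0.
    by apply/funext => x; rewrite /first /= ffunE.
  have step : law rho (fun x : config => x 0) true
            = law rho (fun x : config => x 0) false * (1 - s).
    have sK : K false true = 1 - s.
      by rewrite /parry_kernel /= /eigvec divr1 -expr2 inv_golden_eq.
    rewrite -[LHS](law_coordinate 1)//.
    rewrite -[fun x : config => x 1%Z]/(snd \o next_letter 1).
    rewrite (law_comp rho snd true (@finitely_valued_next_letter 1)).
    rewrite (reindex_onto (fun u => (u, true)) fst) /=; last first.
      by move=> [u b] /= /eqP ->.
    rewrite (eq_bigl xpredT); last by move=> u; rewrite ?eqxx.
    under eq_bigr do rewrite (trho 0%N) /=.
    rewrite -(sum_law_comp rho first (fun a => K a true)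
      (@finitely_valued_word 1)).
    by rewrite firstE big_bool/= sK /parry_kernel /= mulr0 add0r.
  have s2 : 2 - s != 0.
    rewrite gt_eqF// subr_gt0.
    by have := inv_golden_eq R; have := sqr_ge0 s; lra.
  have pt : law rho (fun x : config => x 0) true = (1 - s) / (2 - s).
    apply: (mulIf s2); rewrite divfK//; move: step.
    rewrite (_ : law rho _ false =
      1 - law rho (fun x : config => x 0) true); lra.
  by case; rewrite -pt//; lra.
elim=> [|n IHn] w; last by rewrite !law_wordS tnu tmu !IHn.
have wordE (rho : probability config R) :
    law rho (word 1) w = law rho (fun x : config => x 0) (w ord0).
  congr prob; apply/seteqP; split=> x /=; first by move=> <-; rewrite ffunE.
  by move=> xw; apply/ffunP => i; rewrite ffunE (ord1 i).
by rewrite !wordE !one_point.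
Qed.

End golden_mean.

(** * The Parry measure is the measure of maximal entropy *)

Lemma limn_affine (R : realType) (u : R^nat) (C h : R) :
  (forall n, u n.+1 = C + n.+1%:R * h) -> limn (fun n => u n / n%:R) = h.
Proof.
move=> uC; apply: cvg_lim => //; apply/cvgrPdist_le => e e0; near=> n.
have n0 : (0 < n)%N by near: n; exact: nbhs_infty_gt.
have nR : 0 < n%:R :> R by rewrite ltr0n.
have -> : u n = C + n%:R * h by rewrite -(prednK n0) uC.
have -> : h - (C + n%:R * h) / n%:R = - (C / n%:R).
  by field; rewrite gt_eqF.
rewrite normrN normrM normfV (gtr0_norm nR) ler_pdivrMr// -ler_pdivrMl// mulrC.
by near: n; exact: nbhs_infty_ger.
Unshelve. all: by end_near.
Qed.

Section parry_measure.
Context (R : realType).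
Local Notation s := (inv_golden R).
Local Notation K := (@parry_kernel R).
Local Notation weight := (markov_weight (@parry_start R) K).
Context (mu : probability config R).
Hypothesis mu_weight : forall k w, prob mu (cylinder_at k w) = weight w.

Lemma parry_translation_invariant k : invariant_measure (translate k) mu.
Proof.
have m_translate : measurable_fun setT (translate k).
  apply: (@measurable_fun_config _ config (translate k)) => i b.
  exact: measurable_coordinate.
have [mu' mu'E] := image_probability mu m_translate.
move=> A mA; rewrite -mu'E; apply: same_measure_window => // m u.
rewrite !law_window_cylinder mu_weight -(mu_weight (- m%:Z + k)) /prob mu'E.
congr (fine (mu _)); apply/seteqP; split=> x /= xw j jw.
  by rewrite -xw// /translate; congr x; lia.
by rewrite /translate -xw//; congr x; lia.
Qed.

Let inv : invariant_measure shift_minus mu := parry_translation_invariant 1.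

Lemma parry_B_plus : mu B_plus = 1%E.
Proof.
have null i : mu (cylinder_at i [:: true; true]) = 0%E.
  by rewrite -probE ?mu_weight/= ?mul0r ?mulr0//; exact: measurable_cylinder_at.
suff nC : mu (~` B_plus) = 0%E.
  rewrite -[B_plus]setCK probability_setC ?nC ?sube0//.
  by apply: measurableC; exact: measurable_B_plus.
apply: measure_negligible.
  by apply: measurableC; exact: measurable_B_plus.
pose F n : set config :=
  if unpickle n is Some i then cylinder_at i [:: true; true] else set0.
have : mu.-negligible (\bigcup_n F n).
  apply: negligible_bigcup => n; rewrite /F.
  case: (unpickle n) => [i|]; last exact: negligible_set0.
  by apply/negligibleP; [exact: measurable_cylinder_at|exact: null].
apply: negligibleS => x /existsNP[i /contrapT xi]; exists (pickle i) => //.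
rewrite /F pickleK => -[|[|//]] _ /=; rewrite ?addr0;
  by move: xi; case: (x i); case: (x (i + 1)).
Qed.

Lemma parry_subsystem : subsystem_measure shift_minus B_plus mu.
Proof. by split; [exact: inv|exact: parry_B_plus]. Qed.

Lemma parry_measure_transitions : parry_transitions mu.
Proof.
move=> n [u b]; rewrite law_next_letter_cylinder law_word_cylinder !mu_weight.
rewrite -[(u, b).1]/u -[(u, b).2]/b.
have := size_letters u; have := nth_letters u ord_max.
case: (letters u) => [//|a v] last_u [size_v].
rewrite markov_weight_rcons; congr (_ * K _ _).
by rewrite (last_nth false) size_v -last_u.
Qed.

(** Here the Gibbs inequality against the Parry kernel is an equality at every
    step. *)
Lemma parry_word_entropy n :
  shannon mu (word n.+1) = (shannon mu (word 1) + ln s) + n.+1%:R * - ln s.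
Proof.
elim: n => [|n IHn]; first by rewrite mul1r addrK.
rewrite shannon_wordS.
have [_ /esym] := parry_pair_leif n parry_subsystem.
have -> : [forall z, law mu (next_letter n.+1) z
    == law mu (word n.+1) z.1 * K (z.1 ord_max) z.2].
  by apply/forallP => z; rewrite parry_measure_transitions.
by move=> /esym/eqP ->; rewrite IHn -[n.+2%:R]natr1; ring.
Qed.

(** Itineraries for the partition according to the letter at the origin are
    words, so their entropy is known exactly. *)
Lemma parry_entropy_ge : ((- ln s)%:E <= ks_entropy mu shift_minus)%E.
Proof.
pose l (x : config) : 'I_2 := if x 0 then ord_max else ord0.
pose A (i : 'I_2) : set config := [set x | l x = i].
have ml : finitely_valued l.
  exact: (@finitely_valued_comp _ _ _ _ _
    (fun b : bool => if b then ord_max else ord0 : 'I_2)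
    (finitely_valued_coordinate 0)).
have pA : measurable_partition A.
  split=> //; first by move=> i j _ _ [x [<- <-]].
  by apply/seteqP; split=> // x _; exists (l x).
suff <- : partition_entropy mu shift_minus A = - ln s.
  by apply: ereal_sup_ubound; exists 2%N, A.
apply: (@limn_affine _ _ (shannon mu (word 1) + ln s)) => n.
rewrite (@join_entropy_itinerary _ _ _ _ _ _ _ l)// -parry_word_entropy.
pose enc (u : {ffun 'I_n.+1 -> bool}) : {ffun 'I_n.+1 -> 'I_2} :=
  [ffun i => if u i then ord_max else ord0].
pose dec (v : {ffun 'I_n.+1 -> 'I_2}) : {ffun 'I_n.+1 -> bool} :=
  [ffun i => v i == ord_max].
have encE : enc \o word n.+1 = itinerary shift_minus l n.+1.
  apply/funext => x; apply/ffunP => i.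
  by rewrite !ffunE /l iter_shift_minus /translate add0r.
have decE : dec \o itinerary shift_minus l n.+1 = word n.+1.
  apply/funext => x; apply/ffunP => i.
  by rewrite !ffunE /l iter_shift_minus /translate add0r; case: (x _).
apply/eqP; rewrite eq_le -{1}encE -{3}decE; apply/andP; split.
  apply: (@shannon_comp _ _ _ mu _ _ (word n.+1) enc).
  exact: finitely_valued_word.
apply: (@shannon_comp _ _ _ mu _ _ (itinerary shift_minus l n.+1) dec).
exact: (finitely_valued_itinerary measurable_shift_minus).
Qed.

Lemma parry_the_max_entropy : the_max_entropy_measure shift_minus B_plus mu.
Proof.
split.
  split=> [|nu nuB]; first exact: parry_subsystem.
  exact: le_trans (golden_entropy_le nuB) parry_entropy_ge.
move=> nu [nuB /(_ mu parry_subsystem) nu_max].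
apply: parry_transitions_unique; [by case: nuB|exact: inv| |
  exact: parry_measure_transitions].
exact: max_entropy_parry_transitions nuB (le_trans parry_entropy_ge nu_max).
Qed.

End parry_measure.

Lemma parry_measure_exists (R : realType) : exists mu : probability config R,
  forall k w, prob mu (cylinder_at k w)
    = markov_weight (@parry_start R) (@parry_kernel R) w.
Proof.
apply: word_weights_extend.
- by move=> w; apply: markov_weight_ge0;
    [exact: parry_start_ge0|exact: parry_kernel_ge0].
- by [].
- exact: markov_weight_split_right (@parry_start_sum R) (@parry_kernel_sum R).
- exact: markov_weight_split_left (@parry_start_sum R)
    (@parry_start_stationary R).
Qed.

(** * The lattice process *)

Definition reflect_config (x : config) : config := fun i : int => x (- i).
Definition complement_config (x : config) : config := fun i : int => ~~ x i.

Lemma measurable_reflect : measurable_fun setT reflect_config.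
Proof.
apply: (@measurable_fun_config _ config reflect_config) => i b.
exact: measurable_coordinate.
Qed.

Lemma measurable_complement : measurable_fun setT complement_config.
Proof.
apply: (@measurable_fun_config _ config complement_config) => i b.
rewrite (_ : [set x | _] = [set x : config | x i = ~~ b]).
  exact: measurable_coordinate.
by apply/seteqP; split=> x; rewrite /= /complement_config; case: (x i); case: b.
Qed.

Lemma reflect_configK : involutive reflect_config.
Proof. by move=> x; apply/funext => i; rewrite /reflect_config opprK. Qed.

Lemma complement_configK : involutive complement_config.
Proof. by move=> x; apply/funext => i; rewrite /complement_config negbK. Qed.

Lemma reflect_shift x :
  reflect_config (shift_minus x) = shift_plus (reflect_config x).
Proof.
apply/funext => i; rewrite /reflect_config /shift_plus /shift_minus.
by congr x; lia.
Qed.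

Lemma complement_translate k x :
  complement_config (translate k x) = translate k (complement_config x).
Proof. by []. Qed.

Lemma preimage_reflect_B_plus : reflect_config @^-1` B_plus = B_plus.
Proof.
suff sub x : B_plus x -> B_plus (reflect_config x).
  apply/seteqP; split=> x xB; last exact: sub.
  by rewrite -[x]reflect_configK; exact: sub.
move=> xB i; have := xB (- (i + 1)); rewrite addnC /reflect_config.
by have -> : - (i + 1) + 1 = - i by lia.
Qed.

Lemma preimage_complement_B_minus : complement_config @^-1` B_minus = B_plus.
Proof.
apply/seteqP; split=> x xB i; have := xB i; rewrite /complement_config;
  by case: (x i); case: (x _).
Qed.

Lemma preimage_complement_cylinder w :
  complement_config @^-1` cylinder w = cylinder_at 0 (map negb w).
Proof.
apply/seteqP; split=> x xw j.
  rewrite size_map add0r => jw; rewrite (nth_map false)//.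
  by rewrite -(xw j jw) /complement_config negbK.
move=> jw; rewrite /complement_config -[_%:Z]add0r xw ?size_map//.
by rewrite (nth_map false)// negbK.
Qed.

Lemma eq_prob_full (d : measure_display) (T : measurableType d) (R : realType)
    (mu : probability T R) (B C D : set T) :
  measurable B -> measurable C -> measurable D -> mu B = 1%E ->
  C `&` B = D `&` B -> mu C = mu D.
Proof.
move=> mB mC mD muB CD.
have muC : mu (~` B) = 0%E by rewrite probability_setC// muB subee.
have full E : measurable E -> mu E = mu (E `&` B).
  move=> mE; rewrite (measureDI mu mE mB).
  rewrite (@subset_measure0 _ _ _ mu (E `\` B) (~` B)) ?add0e//.
  - exact: measurableD.
  - exact: measurableC.
by rewrite (full C)// CD -full.
Qed.

Lemma measurable_tasep : measurable_fun setT tasep_map.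
Proof.
apply: (@measurable_fun_config _ config tasep_map) => i b.
apply: (@measurable_local_event (`|i| + 1)) => x y xy /= <-.
by rewrite /tasep_map !xy//; lia.
Qed.

(** An occupied site becomes empty when its right neighbour is empty, and an
    empty one is filled since its left neighbour is occupied. *)
Lemma tasep_B_minus x : B_minus x -> tasep_map x = shift_minus x.
Proof.
move=> xB; apply/funext => i; rewrite /tasep_map /shift_minus.
have := xB i; have := xB (i - 1); rewrite subrK.
by case: (x i); case: (x (i + 1)); case: (x (i - 1)).
Qed.

Lemma tasep_invariant_B_minus (R : realType) (mu : probability config R) :
  subsystem_measure shift_minus B_minus mu -> invariant_measure tasep_map mu.
Proof.
move=> [inv muB] A mA; rewrite -(inv A mA); apply: (eq_prob_full _ _ _ muB).
- rewrite (_ : B_minus = complement_config @^-1` B_plus).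
    exact: (preimage_measurable measurable_complement measurable_B_plus).
  rewrite -preimage_complement_B_minus.
  by apply/seteqP; split=> x /=; rewrite complement_configK.
- exact: (preimage_measurable measurable_tasep mA).
- exact: (preimage_measurable measurable_shift_minus mA).
by apply/seteqP; split=> x /= [xA xB]; split=> //; move: xA;
  rewrite /preimage/= tasep_B_minus.
Qed.

(** Complementation permutes the cylinders at a given position, so the Markov
    equations are those of the chain with the two letters exchanged. *)
Lemma markov_complement_parry (R : realType) (mu mu' : probability config R) :
  (forall k w, prob mu (cylinder_at k w)
    = markov_weight (@parry_start R) (@parry_kernel R) w) ->
  (forall A, mu' A = mu (complement_config @^-1` A)) -> markov_measure mu'.
Proof.
move=> muw mu'E; split=> [k|A C b].
  apply: (invariant_image measurable_complement (complement_translate k) mu'E).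
  exact: parry_translation_invariant muw k.
have cyl w : mu' (cylinder w)
    = (markov_weight (@parry_start R) (@parry_kernel R) (map negb w))%:E.
  rewrite mu'E preimage_complement_cylinder -(muw 0) probE//.
  exact: measurable_cylinder_at.
rewrite !cyl -!EFinM; congr EFin.
rewrite map_cat map_rcons /= mulr1; exact: markov_weight_cat.
Qed.

(** Both the empty and the full configuration are fixed by [tasep_map]; choosing
    the full one with probability [rho] gives the density [rho]. *)
Lemma constant_configurations (R : realType) (rho : R) : 0 <= rho <= 1 ->
  exists mu : probability config R, invariant_measure tasep_map mu /\
    forall i : int, ('E_mu[@occupation R i] = rho%:E)%E.
Proof.
move=> rho01; pose c (b : bool) : config := fun=> b.
have mc : measurable_fun setT c by exact: measurable_fun_config.
have [mu muE] := image_probability (bernoulli_prob rho) mc.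
exists mu; split=> [A mA|i].
  rewrite !muE; congr (bernoulli_prob rho _); apply/seteqP.
  have fixc b : tasep_map (c b) = c b.
    by apply/funext => i; rewrite /tasep_map /c; case: b.
  by split=> b /=; rewrite fixc.
have -> : @occupation R i = \1_[set x : config | x i = true].
  apply/funext => x; rewrite /occupation indicE; congr (nat_of_bool _)%:R.
  by apply/idP/idP; rewrite inE.
rewrite expectation_indic; last exact: measurable_coordinate.
rewrite muE (_ : _ @^-1` _ = [set true]); last by apply/seteqP; split=> -[].
by rewrite /= /bernoulli_prob rho01 fsbig_set1.
Qed.

Theorem theorem5 (R : realType) :
  (exists (mu mu_plus mu_minus : probability config R) (alpha beta : R),
    the_max_entropy_measure shift_plus B_plus mu_plus /\
    the_max_entropy_measure shift_minus B_minus mu_minus /\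
    0 <= alpha /\ 0 <= beta /\ alpha + beta = 1 /\
    (forall A : set config, measurable A ->
       mu A = (alpha%:E * mu_plus A + beta%:E * mu_minus A)%E) /\
    markov_measure mu /\
    invariant_measure tasep_map mu) /\
  (exists mu_ : R -> probability config R,
    forall rho : R, 0 <= rho <= 1 ->
      invariant_measure tasep_map (mu_ rho) /\
      forall i : int, ('E_(mu_ rho)[@occupation R i])%E = rho%:E).
Proof.
have [mu mu_weight] := parry_measure_exists R.
have mu_max := parry_the_max_entropy mu_weight.
have [mu_plus mu_plusE] := image_probability mu measurable_reflect.
have [mu_minus mu_minusE] := image_probability mu measurable_complement.
have plus_max : the_max_entropy_measure shift_plus B_plus mu_plus.
  exact: (the_max_entropy_measure_conjugate measurable_reflect
    measurable_reflect reflect_configK reflect_configK reflect_shift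
    preimage_reflect_B_plus mu_plusE mu_max).
have minus_max : the_max_entropy_measure shift_minus B_minus mu_minus.
  exact: (the_max_entropy_measure_conjugate measurable_complement
    measurable_complement complement_configK complement_configK
    (complement_translate 1) preimage_complement_B_minus mu_minusE mu_max).
split.
  exists mu_minus, mu_plus, mu_minus, 0, 1; do !split=> //.
  - by rewrite add0r.
  - by move=> A mA; rewrite mul0e add0e mul1e.
  - exact: (markov_complement_parry mu_weight mu_minusE).1.
  - exact: (markov_complement_parry mu_weight mu_minusE).2.
  - by apply: tasep_invariant_B_minus; case: minus_max => -[].
have /choice[mu_ mu_P] (rho : R) : exists nu : probability config R,
    0 <= rho <= 1 -> invariant_measure tasep_map nu /\
      forall i : int, ('E_nu[@occupation R i] = rho%:E)%E.
  have [/constant_configurations[nu nuP]|] := boolP (0 <= rho <= 1).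
    by exists nu.
  by exists mu.
by exists mu_.
Qed.
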